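(* Let $H$ be a Hopf $^*$-algebra over $\mathsf{C}$. Consider idempotent non-degenerate $^*$-algebras over $\mathsf{C}$ with $^*$-actions of $H$ whose crossed products with $H$ are non-degenerate. Then the crossed product with $H$ induces groupoid morphisms $$\cdot\rtimes H:\mathsf{Pic}^*_H\longrightarrow\mathsf{Pic}^*\qquad\text{and}\qquad\cdot\rtimes H:\mathsf{Pic}^{\mathrm{str}}_H\longrightarrow\mathsf{Pic}^{\mathrm{str}},$$ where a unit $\mathcal{A}$ is mapped to the crossed product algebra $\mathcal{A}\rtimes H$ and an arrow $[\mathcal{E}]\in\mathsf{Pic}^*_H(\mathcal{B},\mathcal{A})$ (resp. $\mathsf{Pic}^{\mathrm{str}}_H(\mathcal{B},\mathcal{A})$) is mapped to the arrow $[\mathcal{E}\rtimes H]\in\mathsf{Pic}^*(\mathcal{B}\rtimes H,\mathcal{A}\rtimes H)$ (resp. $\mathsf{Pic}^{\mathrm{str}}(\mathcal{B}\rtimes H,\mathcal{A}\rtimes H)$).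
   Context: **Ground ring.** $\mathsf{R}$ is an ordered ring (commutative, unital), $\mathsf{C}=\mathsf{R}(i)$ with $i^2=-1$, with complex conjugation. A $^*$-algebra over $\mathsf{C}$ is an associative $\mathsf{C}$-algebra with a $\mathsf{C}$-antilinear involutive antiautomorphism. It is *idempotent* if products $ab$ span it, *non-degenerate* if $a\mathcal{A}=0$ or $\mathcal{A}a=0$ implies $a=0$. For unital algebras, modules are unital. All modules carry a compatible $\mathsf{C}$-module structure; $\otimes=\otimes_{\mathsf{C}}$. **Hopf $^*$-algebra.** $H$ is a Hopf algebra over $\mathsf{C}$ ($\Delta(g)=g_{(1)}\otimes g_{(2)}$, counit $\epsilon$, antipode $S$) which is also a $^*$-algebra such that $\Delta,\epsilon$ are $^*$-homomorphisms and $S(S(g)^* )^*=g$. A $^*$-action of $H$ on $\mathcal{A}$ is a left $H$-module structure (with $1_H\triangleright a=a$) with $g\triangleright(ab)=(g_{(1)}\triangleright a)(g_{(2)}\triangleright b)$, $(g\triangleright a)^*=S(g)^*\triangleright a^*$, and $g\triangleright1=\epsilon(g)1$ if $\mathcal{A}$ is unital. **Inner products.** $\omega:\mathcal{A}\to\mathsf{C}$ linear is positive if $\omega(a^*a)\ge0$; $a$ is positive if $\omega(a)\ge0$ for all positive $\omega$. An $\mathcal{A}$-valued inner product on a right $\mathcal{A}$-module is $\mathsf{C}$-sesquilinear (linear in the second argument) with $\langle x,y\cdot a\rangle=\langle x,y\rangle a$, $\langle x,y\rangle=\langle y,x\rangle^*$ (on left modules: left linear in the first argument). Non-degenerate: $\langle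 x,\cdot\rangle=0$ implies $x=0$. Full: its values span the algebra. Completely positive: $(\langle x_i,x_j\rangle)$ is positive in $M_n$ of the algebra for all $n$, $x_1,\dots,x_n$. **Picard groupoids.** A $^*$-equivalence bimodule is a $(\mathcal{B},\mathcal{A})$-bimodule $\mathcal{E}$ with $\mathcal{B}\cdot\mathcal{E}=\mathcal{E}=\mathcal{E}\cdot\mathcal{A}$ (spans) and full non-degenerate inner products ${}_{\mathcal{B}}\langle\cdot,\cdot\rangle$ (left $\mathcal{B}$-linear) and $\langle\cdot,\cdot\rangle_{\mathcal{A}}$ (right $\mathcal{A}$-linear) with $\langle b\cdot x,y\rangle_{\mathcal{A}}=\langle x,b^*\cdot y\rangle_{\mathcal{A}}$, ${}_{\mathcal{B}}\langle x\cdot a,y\rangle={}_{\mathcal{B}}\langle x,y\cdot a^*\rangle$, ${}_{\mathcal{B}}\langle x,y\rangle\cdot z=x\cdot\langle y,z\rangle_{\mathcal{A}}$; it is *strong* if both are completely positive; it is *$H$-covariant* if it carries an $H$-module structure with $g\triangleright\langle x,y\rangle_{\mathcal{A}}=\langle S(g_{(1)})^*\triangleright x,g_{(2)}\triangleright y\rangle_{\mathcal{A}}$, $g\triangleright{}_{\mathcal{B}}\langle x,y\rangle={}_{\mathcal{B}}\langle g_{(1)}\triangleright x,S(g_{(2)})^*\triangleright y\rangle$. $\mathsf{Pic}^*(\mathcal{B},\mathcal{A})$, $\mathsf{Pic}^{\mathrm{str}}(\mathcal{B},\mathcal{A})$, $\mathsf{Pic}^*_H(\mathcal{B},\mathcal{A})$,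 $\mathsf{Pic}^{\mathrm{str}}_H(\mathcal{B},\mathcal{A})$ are the classes of isomorphism classes (isomorphisms preserve all structures) of $^*$-, strong, $H$-covariant $^*$- and $H$-covariant strong equivalence bimodules; they are the arrows $\mathcal{A}\to\mathcal{B}$ of (large) groupoids with composition $[\mathcal{F}]\circ[\mathcal{E}]=[\mathcal{F}\widetilde{\otimes}_{\mathcal{B}}\mathcal{E}]$ and units $[{}_{\mathcal{A}}\mathcal{A}_{\mathcal{A}}]$ ($\langle a,b\rangle_{\mathcal{A}}=a^*b$, ${}_{\mathcal{A}}\langle a,b\rangle=ab^*$). $\mathcal{F}\widetilde{\otimes}_{\mathcal{B}}\mathcal{E}$ is $\mathcal{F}\otimes_{\mathcal{B}}\mathcal{E}$ with $\langle y\otimes x,y'\otimes x'\rangle_{\mathcal{A}}=\langle x,\langle y,y'\rangle_{\mathcal{B}}\cdot x'\rangle_{\mathcal{A}}$, ${}_{\mathcal{C}}\langle y\otimes x,y'\otimes x'\rangle={}_{\mathcal{C}}\langle y\cdot{}_{\mathcal{B}}\langle x,x'\rangle,y'\rangle$, divided by the common degeneracy space, with $g\triangleright(y\otimes x)=g_{(1)}\triangleright y\otimes g_{(2)}\triangleright x$. **Crossed products.** $\mathcal{A}\rtimes H$ is $\mathcal{A}\otimes H$ with $(a\otimes g)(b\otimes h)=a(g_{(1)}\triangleright b)\otimes g_{(2)}h$, $(a\otimes g)^*=g_{(1)}^*\triangleright a^*\otimes g_{(2)}^*$. For an $H$-covariant equivalence bimodule $\mathcal{E}$, $\mathcal{E}\otimes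 H$ is a $(\mathcal{B}\rtimes H,\mathcal{A}\rtimes H)$-bimodule via $(b\otimes g)\cdot(x\otimes h)=b\cdot(g_{(1)}\triangleright x)\otimes g_{(2)}h$, $(x\otimes g)\cdot(a\otimes h)=x\cdot(g_{(1)}\triangleright a)\otimes g_{(2)}h$, with inner products $\langle x\otimes g,y\otimes h\rangle_{\mathcal{A}\rtimes H}=(g_{(1)}^*\triangleright\langle x,y\rangle_{\mathcal{A}})\otimes g_{(2)}^*h$ and ${}_{\mathcal{B}\rtimes H}\langle x\otimes g,y\otimes h\rangle={}_{\mathcal{B}}\langle x,S(g_{(1)})^*S^{-1}(h_{(1)})\triangleright y\rangle\otimes g_{(2)}h_{(2)}^*$. The two degeneracy spaces coincide, and $\mathcal{E}\rtimes H$ is the quotient of $\mathcal{E}\otimes H$ by it, with the induced structures. *)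

(* Defs.v *)
From HB Require Import structures.
From mathcomp Require Import all_boot all_order all_algebra.
From mathcomp Require Import boolp classical_sets.
From mathcomp Require Import complex.

Set Implicit Arguments.
Unset Strict Implicit.
Unset Printing Implicit Defensive.

Import Order.TTheory GRing.Theory Num.Theory.

Local Open Scope ring_scope.
Local Open Scope classical_set_scope.
Local Open Scope quotient_scope.

(* An ordered ring (totally ordered, commutative, 1 != 0) has no zero divisors
   and is classically the same thing as a realDomainType.
   The library only equips R[i] with its product when R is a field,
   whence the alias Cx R. *)

Definition Cx (R : realDomainType) : Type := complex R.

Section Scalars.
Variable R : realDomainType.

HB.instance Definition _ := GRing.Zmodule.copy (Cx R) (complex R : zmodType).

Let one : Cx R := Complex 1 0.
Let mul : Cx R -> Cx R -> Cx R := @ComplexField.mulc R.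

Let mul1 : left_id one mul.
Proof. by case=> a b; rewrite /mul /= !mul1r !mul0r subr0 addr0. Qed.

Let mulDl : left_distributive mul +%R.
Proof.
move=> [a b] [c d] [e f]; rewrite /mul /= !mulrDl opprD.
by congr Complex; exact: addrACA.
Qed.

Let one_neq0 : one != 0.
Proof. by rewrite eq_complex /= oner_eq0. Qed.

HB.instance Definition _ := GRing.Zmodule_isComNzRing.Build (Cx R)
  (@ComplexField.mulcA R) (@ComplexField.mulcC R) mul1 mulDl one_neq0.

Definition conj (z : Cx R) : Cx R := conjc z.

Definition nneg (z : Cx R) : Prop := complex.Im z = 0 /\ 0 <= complex.Re z.

End Scalars.

Section Span.
Variables (K : nzRingType) (M : lmodType K).

Definition span (S : set M) : set M :=
  [set v | exists2 s : seq (K * M),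
     (forall p, p \in s -> S p.2) & v = \sum_(p <- s) p.1 *: p.2].

Lemma span0 S : span S 0.
Proof. by exists [::]; rewrite ?big_nil. Qed.

Lemma spanD S u v : span S u -> span S v -> span S (u + v).
Proof.
move=> [s sS ->] [t tS ->]; exists (s ++ t); last by rewrite big_cat.
by move=> p; rewrite mem_cat => /orP[/sS|/tS].
Qed.

Lemma spanZ S c u : span S u -> span S (c *: u).
Proof.
move=> [s sS ->]; exists [seq (c * p.1, p.2) | p <- s].
  by move=> _ /mapP[p /sS ? ->].
by rewrite big_map scaler_sumr; apply: eq_bigr => p _; rewrite scalerA.
Qed.

Lemma spanN S u : span S u -> span S (- u).
Proof. by move=> /(spanZ (-1)); rewrite scaleN1r. Qed.

Lemma span_sub S : S `<=` span S.
Proof.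
move=> v Sv; exists [:: (1, v)]; last by rewrite big_seq1 scale1r.
by move=> p; rewrite inE => /eqP->.
Qed.

End Span.

(* quotmod S is the quotient of M by the submodule spanned by S *)
Section QuotientModule.
Variables (K : nzRingType) (M : lmodType K) (S : set M).

Definition qm_rel (x y : M) : bool := `[< span S (x - y) >].

Lemma qm_relP : equiv_class_of qm_rel.
Proof.
split=> [x|x y|y x z].
- by apply/asboolP; rewrite subrr; exact: span0.
- by apply/asboolP/asboolP => /spanN; rewrite opprB.
- move=> /asboolP xy /asboolP yz; apply/asboolP.
  by have := spanD xy yz; rewrite addrA subrK.
Qed.

Canonical qm_equiv := EquivRelPack qm_relP.

Definition quotmod : Type := {eq_quot qm_rel}.

HB.instance Definition _ := Choice.on quotmod.
HB.instance Definition _ := EqQuotient.on quotmod.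

Definition qproj (x : M) : quotmod := \pi_quotmod x.
Definition qrepr (u : quotmod) : M := repr u.

Lemma qreprK : cancel qrepr qproj.
Proof. exact: reprK. Qed.

Lemma qprojP (P : quotmod -> Prop) : (forall x, P (qproj x)) -> forall u, P u.
Proof. by move=> h u; rewrite -[u]qreprK. Qed.

Lemma qproj_eqP (x y : M) : qproj x = qproj y <-> span S (x - y).
Proof.
split=> [/eqP|h]; first by rewrite eqquotE => /asboolP.
by apply/eqP; rewrite eqquotE; apply/asboolP.
Qed.

Lemma qreprE (x : M) : span S (qrepr (qproj x) - x).
Proof. by apply/qproj_eqP; rewrite qreprK. Qed.

Definition qm_add (u v : quotmod) : quotmod := qproj (qrepr u + qrepr v).
Definition qm_opp (u : quotmod) : quotmod := qproj (- qrepr u).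
Definition qm_scale (c : K) (u : quotmod) : quotmod := qproj (c *: qrepr u).

Let projD x y : qm_add (qproj x) (qproj y) = qproj (x + y).
Proof. by apply/qproj_eqP; rewrite opprD addrACA; apply: spanD; apply: qreprE. Qed.

Let projN x : qm_opp (qproj x) = qproj (- x).
Proof. by apply/qproj_eqP; rewrite -opprD; apply/spanN/qreprE. Qed.

Let projZ c x : qm_scale c (qproj x) = qproj (c *: x).
Proof. by apply/qproj_eqP; rewrite -scalerBr; apply/spanZ/qreprE. Qed.

Let qm_addA : associative qm_add.
Proof.
elim/qprojP=> x; elim/qprojP=> y; elim/qprojP=> z.
by rewrite (projD y) (projD x) (projD x) (projD (x + y)) addrA.
Qed.

Let qm_addC : commutative qm_add.
Proof. by move=> u v; rewrite /qm_add addrC. Qed.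

Let qm_add0 : left_id (qproj 0) qm_add.
Proof. by elim/qprojP=> x; rewrite projD add0r. Qed.

Let qm_addN : left_inverse (qproj 0) qm_opp qm_add.
Proof. by elim/qprojP=> x; rewrite projN projD addNr. Qed.

HB.instance Definition _ :=
  GRing.isZmodule.Build quotmod qm_addA qm_addC qm_add0 qm_addN.

Let qm_scaleA a b u : qm_scale a (qm_scale b u) = qm_scale (a * b) u.
Proof. by elim/qprojP: u => x; rewrite (projZ b) !projZ scalerA. Qed.

Let qm_scale1 : left_id 1 qm_scale.
Proof. by elim/qprojP=> x; rewrite projZ scale1r. Qed.

Let qm_scaleDr : right_distributive qm_scale +%R.
Proof.
move=> a; elim/qprojP=> x; elim/qprojP=> y.
by rewrite [_ + _]projD !projZ [RHS]projD scalerDr.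
Qed.

Let qm_scaleDl u : {morph qm_scale^~ u : a b / a + b}.
Proof.
by move=> a b; elim/qprojP: u => x; rewrite !projZ [RHS]projD scalerDl.
Qed.

HB.instance Definition _ := GRing.Zmodule_isLmodule.Build K quotmod
  qm_scaleA qm_scale1 qm_scaleDr qm_scaleDl.

Lemma qproj_linear : linear qproj.
Proof. by move=> c x y; rewrite -projD -projZ. Qed.

End QuotientModule.
Arguments quotmod {K M} S.
Arguments qproj {K M} S x.

(* tensor M N consists of formal sums of pairs; two of them are identified when
   no balanced map into an abelian group separates them (universal property) *)
Section Tensor.
Variables (K : comNzRingType) (M N : lmodType K).

Record balanced (P : zmodType) (f : M -> N -> P) : Prop := Balanced {
  balancedDl : forall x x' y, f (x + x') y = f x y + f x' y;
  balancedDr : forall x y y', f x (y + y') = f x y + f x y';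
  balancedZ : forall c x y, f (c *: x) y = f x (c *: y) }.

Definition evalt (P : zmodType) (f : M -> N -> P) (s : seq (M * N)) : P :=
  \sum_(p <- s) f p.1 p.2.

Definition tens_rel (s t : seq (M * N)) : bool :=
  `[< forall (P : zmodType) (f : M -> N -> P), balanced f ->
        evalt f s = evalt f t >].

Lemma tens_relP : equiv_class_of tens_rel.
Proof.
split=> [s|s t|t s u]; first exact/asboolP.
- by apply/asboolP/asboolP => h P f bf; rewrite h.
- by move=> /asboolP h /asboolP k; apply/asboolP => P f bf; rewrite h ?k.
Qed.

Canonical tens_equiv := EquivRelPack tens_relP.

Definition tensor : Type := {eq_quot tens_rel}.

HB.instance Definition _ := Choice.on tensor.
HB.instance Definition _ := EqQuotient.on tensor.

Definition tproj (s : seq (M * N)) : tensor := \pi_tensor s.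
Definition trepr (t : tensor) : seq (M * N) := repr t.

Lemma treprK : cancel trepr tproj.
Proof. exact: reprK. Qed.

Lemma tprojP (P : tensor -> Prop) : (forall s, P (tproj s)) -> forall t, P t.
Proof. by move=> h t; rewrite -[t]treprK. Qed.

Lemma tproj_eqP (s t : seq (M * N)) : tproj s = tproj t <->
  forall (P : zmodType) (f : M -> N -> P), balanced f -> evalt f s = evalt f t.
Proof.
split=> [/eqP|h]; first by rewrite eqquotE => /asboolP.
by apply/eqP; rewrite eqquotE; apply/asboolP.
Qed.

Definition tens (x : M) (y : N) : tensor := tproj [:: (x, y)].

(* the additive map induced by f; only meaningful when f is balanced *)
Definition tlift (P : zmodType) (f : M -> N -> P) (t : tensor) : P :=
  evalt f (trepr t).

Lemma tlift_proj (P : zmodType) (f : M -> N -> P) s :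
  balanced f -> tlift f (tproj s) = evalt f s.
Proof.
by rewrite /tlift => bf; move: P f bf; apply/tproj_eqP; rewrite treprK.
Qed.

Let scaleseq (c : K) (s : seq (M * N)) := [seq (c *: p.1, p.2) | p <- s].

Definition tens_add (t u : tensor) : tensor := tproj (trepr t ++ trepr u).
Definition tens_scale (c : K) (t : tensor) : tensor :=
  tproj [seq (c *: p.1, p.2) | p <- trepr t].

Let evalt_cat (P : zmodType) (f : M -> N -> P) s t :
  evalt f (s ++ t) = evalt f s + evalt f t.
Proof. exact: big_cat. Qed.

Let evalt_scale (P : zmodType) (f : M -> N -> P) c s :
  evalt f (scaleseq c s) = evalt (fun x y => f (c *: x) y) s.
Proof. exact: big_map. Qed.

Let evaltD (P : zmodType) (f g : M -> N -> P) s :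
  evalt (fun x y => f x y + g x y) s = evalt f s + evalt g s.
Proof. exact: big_split. Qed.

Let balanced_scale (P : zmodType) (f : M -> N -> P) c :
  balanced f -> balanced (fun x y => f (c *: x) y).
Proof.
case=> fDl fDr fZ; split=> [x x' y|x y y'|d x y].
- by rewrite scalerDr fDl.
- by rewrite fDr.
- by rewrite scalerA mulrC -scalerA fZ.
Qed.

Let projD s t : tens_add (tproj s) (tproj t) = tproj (s ++ t).
Proof.
apply/tproj_eqP => P f bf; rewrite !evalt_cat.
by rewrite -!(tlift_proj _ bf) !treprK.
Qed.

Let projZ c s : tens_scale c (tproj s) = tproj (scaleseq c s).
Proof.
apply/tproj_eqP => P f bf; rewrite !evalt_scale.
by rewrite -!(tlift_proj _ (balanced_scale c bf)) treprK.
Qed.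

Let tens_addA : associative tens_add.
Proof.
elim/tprojP=> r; elim/tprojP=> s; elim/tprojP=> t.
by rewrite (projD s) (projD r) (projD r) (projD (r ++ s)) catA.
Qed.

Let tens_addC : commutative tens_add.
Proof.
elim/tprojP=> s; elim/tprojP=> t; rewrite !projD.
by apply/tproj_eqP => P f bf; rewrite !evalt_cat addrC.
Qed.

Let tens_add0 : left_id (tproj [::]) tens_add.
Proof. by elim/tprojP=> s; rewrite projD. Qed.

Let tens_addN : left_inverse (tproj [::]) (tens_scale (-1)) tens_add.
Proof.
elim/tprojP=> s; rewrite projZ projD; apply/tproj_eqP => P f bf.
rewrite evalt_cat evalt_scale -evaltD [RHS]big_nil; apply: big1 => p _.
rewrite -(balancedDl bf) scaleN1r addNr.
by apply: (addrI (f 0 p.2)); rewrite -(balancedDl bf) !addr0.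
Qed.

HB.instance Definition _ :=
  GRing.isZmodule.Build tensor tens_addA tens_addC tens_add0 tens_addN.

Let tens_scaleA a b t : tens_scale a (tens_scale b t) = tens_scale (a * b) t.
Proof.
elim/tprojP: t => s; rewrite (projZ b) !projZ; congr tproj.
by rewrite /scaleseq -map_comp; apply: eq_map => p /=; rewrite scalerA.
Qed.

Let tens_scale1 : left_id 1 tens_scale.
Proof.
elim/tprojP=> s; rewrite projZ; congr tproj.
by rewrite -[RHS]map_id; apply: eq_map => -[x y] /=; rewrite scale1r.
Qed.

Let tens_scaleDr : right_distributive tens_scale +%R.
Proof.
move=> a; elim/tprojP=> r; elim/tprojP=> s.
by rewrite [_ + _]projD !projZ [RHS]projD /scaleseq map_cat.
Qed.

Let tens_scaleDl t : {morph tens_scale^~ t : a b / a + b}.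
Proof.
move=> a b; elim/tprojP: t => s; rewrite !projZ [RHS]projD.
apply/tproj_eqP => P f bf; rewrite evalt_cat !evalt_scale -evaltD.
by apply: eq_bigr => p _; rewrite scalerDl (balancedDl bf).
Qed.

HB.instance Definition _ := GRing.Zmodule_isLmodule.Build K tensor
  tens_scaleA tens_scale1 tens_scaleDr tens_scaleDl.

Lemma tensDl x x' y : tens (x + x') y = tens x y + tens x' y.
Proof.
rewrite [RHS]projD; apply/tproj_eqP => P f bf.
by rewrite evalt_cat /evalt !big_seq1 (balancedDl bf).
Qed.

Lemma tensDr x y y' : tens x (y + y') = tens x y + tens x y'.
Proof.
rewrite [RHS]projD; apply/tproj_eqP => P f bf.
by rewrite evalt_cat /evalt !big_seq1 (balancedDr bf).
Qed.

Lemma tensZl c x y : tens (c *: x) y = c *: tens x y.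
Proof. by rewrite [RHS]projZ. Qed.

Lemma tensZr c x y : tens x (c *: y) = c *: tens x y.
Proof.
rewrite -tensZl; apply/tproj_eqP => P f bf.
by rewrite /evalt !big_seq1 (balancedZ bf).
Qed.

Lemma tlift_tens (P : zmodType) (f : M -> N -> P) x y :
  balanced f -> tlift f (tens x y) = f x y.
Proof. by move=> bf; rewrite tlift_proj // /evalt big_seq1. Qed.

Lemma tliftD (P : zmodType) (f : M -> N -> P) :
  balanced f -> {morph tlift f : t u / t + u}.
Proof. by move=> bf t u; rewrite [LHS]tlift_proj // evalt_cat. Qed.

Lemma tensor_sum (t : tensor) : t = \sum_(p <- trepr t) tens p.1 p.2.
Proof.
rewrite -{1}[t]treprK; elim: (trepr t) => [|[x y] s IH]; first by rewrite big_nil.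
by rewrite big_cons -IH [RHS]projD.
Qed.

End Tensor.

(* Sweedler notation: sum over the pairs (x, y) with t = \sum x ⊗ y *)
Notation "\tsum_ ( x , y <- t ) e" := (tlift (fun x y => e) t)
  (at level 41, x binder, y binder, t at level 60, e at level 41,
   format "'[' \tsum_ ( x ,  y  <-  t ) '/  '  e ']'") : ring_scope.

Infix "⊗" := tens (at level 40, left associativity) : ring_scope.

Section Maps.
Variable R : realDomainType.
Implicit Types U V W : lmodType (Cx R).

Definition antilinear U V (f : U -> V) : Prop :=
  linear_for (fun c v => conj c *: v) f.

Definition bilinear U V W (f : U -> V -> W) : Prop :=
  (forall u, linear (f u)) /\ (forall v, linear (f^~ v)).

Definition sesquilinear U V W (f : U -> V -> W) : Prop :=
  (forall u, linear (f u)) /\ (forall v, antilinear (f^~ v)).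

End Maps.

Record star_alg (R : realDomainType) : Type := StarAlg {
  sa_car :> lmodType (Cx R);
  sa_mul : sa_car -> sa_car -> sa_car;
  sa_star : sa_car -> sa_car }.

Notation "a ·m b" := (sa_mul a b) (at level 40, left associativity) : ring_scope.
Notation "a ^★" := (sa_star a) (at level 2, format "a ^★") : ring_scope.

Section StarAlgebras.
Variable R : realDomainType.
Implicit Types A : star_alg R.

Record is_star_alg A : Prop := {
  sa_bilinear : bilinear (@sa_mul R A);
  sa_assoc : associative (@sa_mul R A);
  sa_antilinear : antilinear (@sa_star R A);
  sa_starK : involutive (@sa_star R A);
  sa_starM : forall a b : A, (a ·m b)^★ = b^★ ·m a^★ }.

Definition idempotent_alg A : Prop :=
  forall c : A, span [set d | exists a b : A, d = a ·m b] c.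

Definition nondegenerate_alg A : Prop := forall a : A,
  (forall b : A, a ·m b = 0) \/ (forall b : A, b ·m a = 0) -> a = 0.

Definition is_unit A (e : A) : Prop := forall a : A, e ·m a = a /\ a ·m e = a.

Definition positive_functional A (omega : A -> Cx R) : Prop :=
  scalar omega /\ forall a : A, nneg (omega (a^★ ·m a)).

Definition positive_elt A (a : A) : Prop :=
  forall omega : A -> Cx R, positive_functional omega -> nneg (omega a).

(* M_n(A); 'M[A]_n carries no Cx R-module structure *)
Definition mat_alg n A : star_alg R :=
  @StarAlg R {ffun 'I_n * 'I_n -> A}
    (fun a b => [ffun p => \sum_k a (p.1, k) ·m b (k, p.2)])
    (fun a => [ffun p => (a (p.2, p.1))^★]).

End StarAlgebras.

Record hopf_star_alg (R : realDomainType) : Type := HopfStarAlg {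
  hopf_car :> algType (Cx R);
  Delta : hopf_car -> tensor hopf_car hopf_car;
  eps : hopf_car -> Cx R;
  antipode : hopf_car -> hopf_car;
  hstar : hopf_car -> hopf_car;
  Delta_linear : linear Delta;
  eps_scalar : scalar eps;
  antipode_linear : linear antipode;
  coassociative : forall g,
    \tsum_(g12, g3 <- Delta g) \tsum_(g1, g2 <- Delta g12) g1 ⊗ (g2 ⊗ g3) =
    \tsum_(g1, g23 <- Delta g) \tsum_(g2, g3 <- Delta g23) g1 ⊗ (g2 ⊗ g3);
  counitl : forall g, \tsum_(g1, g2 <- Delta g) eps g1 *: g2 = g;
  counitr : forall g, \tsum_(g1, g2 <- Delta g) eps g2 *: g1 = g;
  Delta1 : Delta 1 = 1 ⊗ 1;
  DeltaM : forall g h, Delta (g * h) =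
    \tsum_(g1, g2 <- Delta g) \tsum_(h1, h2 <- Delta h) (g1 * h1) ⊗ (g2 * h2);
  eps1 : eps 1 = 1;
  epsM : {morph eps : g h / g * h};
  antipodel : forall g, \tsum_(g1, g2 <- Delta g) antipode g1 * g2 = (eps g)%:A;
  antipoder : forall g, \tsum_(g1, g2 <- Delta g) g1 * antipode g2 = (eps g)%:A;
  hstar_antilinear : antilinear hstar;
  hstarK : involutive hstar;
  hstarM : forall g h, hstar (g * h) = hstar h * hstar g;
  Delta_star : forall g,
    Delta (hstar g) = \tsum_(g1, g2 <- Delta g) hstar g1 ⊗ hstar g2;
  eps_star : forall g, eps (hstar g) = conj (eps g);
  antipode_star : forall g, hstar (antipode (hstar (antipode g))) = g }.

Section Covariance.
Variables (R : realDomainType) (H : hopf_star_alg R).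
Implicit Types g h : H.

Local Notation S := (@antipode R H).

Definition antipode_inv (g : H) : H := hstar (S (hstar g)).
Local Notation Sinv := antipode_inv.

Lemma antipodeK : cancel S Sinv.
Proof. by move=> g; rewrite /Sinv antipode_star. Qed.

Lemma antipode_invK : cancel Sinv S.
Proof.
move=> g; rewrite /Sinv -[RHS]hstarK -[X in _ = hstar X]antipode_star.
by rewrite hstarK.
Qed.

Record h_star_alg : Type := HStarAlg {
  hsa_alg :> star_alg R;
  hsa_act : H -> hsa_alg -> hsa_alg }.

Record is_h_module (V : lmodType (Cx R)) (act : H -> V -> V) : Prop := {
  hm_bilinear : bilinear act;
  hm_mul : forall g h v, act (g * h) v = act g (act h v);
  hm_one : forall v, act 1 v = v }.

Notation "g ▷ a" := (hsa_act g a) (at level 30, right associativity).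

Record is_star_action (A : h_star_alg) : Prop := {
  hsa_module : is_h_module (@hsa_act A);
  hsa_mul : forall g (a b : A), g ▷ (a ·m b) =
    \tsum_(g1, g2 <- Delta g) (g1 ▷ a) ·m (g2 ▷ b);
  hsa_star : forall g (a : A), (g ▷ a)^★ = hstar (S g) ▷ a^★;
  hsa_unit : forall g (e : A), is_unit e -> g ▷ e = eps g *: e }.

Definition crossed (A : h_star_alg) : star_alg R :=
  @StarAlg R (tensor A H)
    (fun t u => \tsum_(a, g <- t) \tsum_(b, h <- u)
       \tsum_(g1, g2 <- Delta g) (a ·m (g1 ▷ b)) ⊗ (g2 * h))
    (fun t => \tsum_(a, g <- t)
       \tsum_(g1, g2 <- Delta g) (hstar g1 ▷ a^★) ⊗ hstar g2).

End Covariance.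

Notation "g ▷ a" := (hsa_act g a) (at level 30, right associativity) : ring_scope.

(* lip takes values in the left algebra B, rip in the right algebra A *)
Record bimod (R : realDomainType) (B A : star_alg R) : Type := Bimod {
  bm_car :> lmodType (Cx R);
  lact : B -> bm_car -> bm_car;
  ract : bm_car -> A -> bm_car;
  lip : bm_car -> bm_car -> B;
  rip : bm_car -> bm_car -> A }.

Notation "b ·l x" := (lact b x) (at level 40, left associativity) : ring_scope.
Notation "x ·r a" := (ract x a) (at level 40, left associativity) : ring_scope.
Notation "⟨ x , y ⟩l" := (lip x y) (at level 0, x, y at level 99) : ring_scope.
Notation "⟨ x , y ⟩r" := (rip x y) (at level 0, x, y at level 99) : ring_scope.

Section Bimodules.
Variable R : realDomainType.
Implicit Types A B C : star_alg R.

Record is_bimodule B A (E : bimod B A) : Prop := {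
  lact_bilinear : bilinear (@lact R B A E);
  ract_bilinear : bilinear (@ract R B A E);
  lactA : forall (b c : B) (x : E), (b ·m c) ·l x = b ·l (c ·l x);
  ractA : forall (x : E) (a c : A), x ·r (a ·m c) = (x ·r a) ·r c;
  lractA : forall (b : B) (x : E) (a : A), (b ·l x) ·r a = b ·l (x ·r a);
  lact_unit : forall (e : B) (x : E), is_unit e -> e ·l x = x;
  ract_unit : forall (e : A) (x : E), is_unit e -> x ·r e = x }.

Record is_equivalence_bimodule B A (E : bimod B A) : Prop := {
  eb_bimodule : is_bimodule E;
  lact_full : forall z : E, span [set y | exists (b : B) (x : E), y = b ·l x] z;
  ract_full : forall z : E, span [set y | exists (x : E) (a : A), y = x ·r a] z;
  rip_sesquilinear : sesquilinear (@rip R B A E);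
  rip_ract : forall (x y : E) (a : A), ⟨x, y ·r a⟩r = ⟨x, y⟩r ·m a;
  rip_sym : forall x y : E, ⟨x, y⟩r = ⟨y, x⟩r^★;
  rip_nondeg : forall x : E, (forall y, ⟨x, y⟩r = 0) -> x = 0;
  rip_full : forall a : A, span [set c | exists x y : E, c = ⟨x, y⟩r] a;
  lip_sesquilinear : sesquilinear (fun y x : E => ⟨x, y⟩l);
  lip_lact : forall (b : B) (x y : E), ⟨b ·l x, y⟩l = b ·m ⟨x, y⟩l;
  lip_sym : forall x y : E, ⟨x, y⟩l = ⟨y, x⟩l^★;
  lip_nondeg : forall x : E, (forall y, ⟨x, y⟩l = 0) -> x = 0;
  lip_full : forall b : B, span [set c | exists x y : E, c = ⟨x, y⟩l] b;
  rip_lact : forall (b : B) (x y : E), ⟨b ·l x, y⟩r = ⟨x, b^★ ·l y⟩r;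
  lip_ract : forall (x y : E) (a : A), ⟨x ·r a, y⟩l = ⟨x, y ·r a^★⟩l;
  lip_rip : forall x y z : E, ⟨x, y⟩l ·l z = x ·r ⟨y, z⟩r }.

Definition completely_positive A (V : Type) (ip : V -> V -> A) : Prop :=
  forall n (x : 'I_n -> V),
    positive_elt ([ffun p => ip (x p.1) (x p.2)] : mat_alg n A).

Definition is_strong_equivalence_bimodule B A (E : bimod B A) : Prop :=
  [/\ is_equivalence_bimodule E, completely_positive (@lip R B A E)
    & completely_positive (@rip R B A E)].

Definition preserves_bimod B A (E F : bimod B A) (phi : E -> F) : Prop :=
  [/\ linear phi,
      forall b x, phi (b ·l x) = b ·l phi x,
      forall x a, phi (x ·r a) = phi x ·r a,
      forall x y, ⟨phi x, phi y⟩l = ⟨x, y⟩l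
    & forall x y, ⟨phi x, phi y⟩r = ⟨x, y⟩r].

Definition bimod_iso B A (E F : bimod B A) : Prop :=
  exists phi : E -> F, bijective phi /\ preserves_bimod phi.

Definition bimod_unit A : bimod A A :=
  @Bimod R A A A (@sa_mul R A) (@sa_mul R A)
    (fun a b => a ·m b^★) (fun a b => a^★ ·m b).

Definition bimod_quot B A (E : bimod B A) (S : set E) : bimod B A :=
  @Bimod R B A (quotmod S)
    (fun b u => qproj S (b ·l qrepr u)) (fun u a => qproj S (qrepr u ·r a))
    (fun u v => ⟨qrepr u, qrepr v⟩l) (fun u v => ⟨qrepr u, qrepr v⟩r).

(* In all uses below this is also the degeneracy space of lip. *)
Definition degeneracy B A (E : bimod B A) : set E :=
  [set x | forall y, ⟨x, y⟩r = 0].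

Definition bimod_tens C B A (F : bimod C B) (E : bimod B A) : bimod C A :=
  @Bimod R C A (tensor F E)
    (fun c t => \tsum_(y, x <- t) (c ·l y) ⊗ x)
    (fun t a => \tsum_(y, x <- t) y ⊗ (x ·r a))
    (fun t t' => \tsum_(y, x <- t) \tsum_(y', x' <- t') ⟨y ·r ⟨x, x'⟩l, y'⟩l)
    (fun t t' => \tsum_(y, x <- t) \tsum_(y', x' <- t') ⟨x, ⟨y, y'⟩r ·l x'⟩r).

Definition balancing C B A (F : bimod C B) (E : bimod B A) :
    set (bimod_tens F E) :=
  [set d : tensor F E | exists (y : F) (b : B) (x : E),
     d = (y ·r b) ⊗ x - y ⊗ (b ·l x)].

Definition bimod_btens C B A (F : bimod C B) (E : bimod B A) : bimod C A :=
  bimod_quot (@balancing C B A F E).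

Definition bimod_comp C B A (F : bimod C B) (E : bimod B A) : bimod C A :=
  bimod_quot (@degeneracy C A (bimod_btens F E)).

End Bimodules.
Arguments bimod_quot {R B A E} S.
Arguments balancing {R C B A} F E.
Arguments degeneracy {R B A} E.

Record h_bimod (R : realDomainType) (H : hopf_star_alg R)
    (B A : h_star_alg H) : Type := HBimod {
  hb_bimod :> bimod B A;
  hb_act : H -> hb_bimod -> hb_bimod }.

Notation "g ▶ x" := (hb_act g x) (at level 30, right associativity) : ring_scope.

Section CovariantBimodules.
Variables (R : realDomainType) (H : hopf_star_alg R).
Implicit Types A B C : h_star_alg H.

Local Notation S := (@antipode R H).
Local Notation Sinv := (@antipode_inv R H).

Record is_covariant B A (E : h_bimod B A) : Prop := {
  hb_module : is_h_module (@hb_act R H B A E);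
  hb_rip : forall (g : H) (x y : E), g ▷ ⟨x, y⟩r =
    \tsum_(g1, g2 <- Delta g) ⟨hstar (S g1) ▶ x, g2 ▶ y⟩r;
  hb_lip : forall (g : H) (x y : E), g ▷ ⟨x, y⟩l =
    \tsum_(g1, g2 <- Delta g) ⟨g1 ▶ x, hstar (S g2) ▶ y⟩l }.

Definition h_bimod_iso B A (E F : h_bimod B A) : Prop :=
  exists phi : E -> F, [/\ bijective phi, preserves_bimod phi
    & forall g x, phi (g ▶ x) = g ▶ phi x].

Definition h_bimod_unit A : h_bimod A A :=
  @HBimod R H A A (bimod_unit A) (@hsa_act R H A).

Definition h_bimod_quot B A (E : h_bimod B A) (D : set E) : h_bimod B A :=
  @HBimod R H B A (bimod_quot D) (fun g u => qproj D (g ▶ qrepr u)).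

Definition h_bimod_tens C B A (F : h_bimod C B) (E : h_bimod B A) :
    h_bimod C A :=
  @HBimod R H C A (bimod_tens F E) (fun g t => \tsum_(y, x <- t)
    \tsum_(g1, g2 <- Delta g) (g1 ▶ y) ⊗ (g2 ▶ x)).

Definition h_bimod_btens C B A (F : h_bimod C B) (E : h_bimod B A) :
    h_bimod C A :=
  @h_bimod_quot C A (h_bimod_tens F E) (balancing F E).

Definition h_bimod_comp C B A (F : h_bimod C B) (E : h_bimod B A) :
    h_bimod C A :=
  @h_bimod_quot C A (h_bimod_btens F E) (degeneracy (bimod_btens F E)).

Definition crossed_pre B A (E : h_bimod B A) : bimod (crossed B) (crossed A) :=
  @Bimod R (crossed B) (crossed A) (tensor E H)
    (fun s t => \tsum_(b, g <- s) \tsum_(x, h <- t)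
       \tsum_(g1, g2 <- Delta g) (b ·l (g1 ▶ x)) ⊗ (g2 * h))
    (fun t s => \tsum_(x, g <- t) \tsum_(a, h <- s)
       \tsum_(g1, g2 <- Delta g) (x ·r (g1 ▷ a)) ⊗ (g2 * h))
    (fun t u => \tsum_(x, g <- t) \tsum_(y, h <- u)
       \tsum_(g1, g2 <- Delta g) \tsum_(h1, h2 <- Delta h)
         ⟨x, (hstar (S g1) * Sinv h1) ▶ y⟩l ⊗ (g2 * hstar h2))
    (fun t u => \tsum_(x, g <- t) \tsum_(y, h <- u)
       \tsum_(g1, g2 <- Delta g) (hstar g1 ▷ ⟨x, y⟩r) ⊗ (hstar g2 * h)).

Definition crossed_bimod B A (E : h_bimod B A) : bimod (crossed B) (crossed A) :=
  bimod_quot (degeneracy (crossed_pre E)).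

End CovariantBimodules.

(* A large groupoid whose objects are the X : obj with is_obj X and whose
   arrows X -> Y are the classes modulo eq_arr of those E : arr Y X with
   is_arr E; composition and units are given on representatives. *)
Record groupoid_pres : Type := GroupoidPres {
  obj : Type;
  is_obj : obj -> Prop;
  arr : obj -> obj -> Type;
  is_arr : forall Y X, arr Y X -> Prop;
  eq_arr : forall Y X, arr Y X -> arr Y X -> Prop;
  comp : forall Z Y X, arr Z Y -> arr Y X -> arr Z X;
  unit_arr : forall X, arr X X }.

Record groupoid_morphism (G G' : groupoid_pres) (Phi0 : obj G -> obj G')
    (Phi : forall Y X : obj G, arr Y X -> arr (Phi0 Y) (Phi0 X)) : Prop := {
  gm_obj : forall X : obj G, is_obj X -> is_obj (Phi0 X);
  gm_arr : forall (Y X : obj G) (E : arr Y X), is_obj Y -> is_obj X ->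
    is_arr E -> is_arr (Phi Y X E);
  gm_eq : forall (Y X : obj G) (E E' : arr Y X), is_obj Y -> is_obj X ->
    is_arr E -> is_arr E' -> eq_arr E E' -> eq_arr (Phi Y X E) (Phi Y X E');
  gm_comp : forall (Z Y X : obj G) (F : arr Z Y) (E : arr Y X),
    is_obj Z -> is_obj Y -> is_obj X -> is_arr F -> is_arr E ->
    eq_arr (Phi Z X (comp F E)) (comp (Phi Z Y F) (Phi Y X E));
  gm_unit : forall X : obj G, is_obj X ->
    eq_arr (Phi X X (unit_arr X)) (unit_arr (Phi0 X)) }.

Section Picard.
Variable R : realDomainType.

Definition pic_obj (A : star_alg R) : Prop :=
  [/\ is_star_alg A, idempotent_alg A & nondegenerate_alg A].

Definition Pic_star : groupoid_pres :=
  @GroupoidPres (star_alg R) pic_obj (@bimod R)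
    (@is_equivalence_bimodule R) (@bimod_iso R) (@bimod_comp R) (@bimod_unit R).

Definition Pic_str : groupoid_pres :=
  @GroupoidPres (star_alg R) pic_obj (@bimod R)
    (@is_strong_equivalence_bimodule R) (@bimod_iso R) (@bimod_comp R)
    (@bimod_unit R).

Variable H : hopf_star_alg R.

Definition picH_obj (A : h_star_alg H) : Prop :=
  [/\ pic_obj A, is_star_action A & nondegenerate_alg (crossed A)].

Definition PicH_star : groupoid_pres :=
  @GroupoidPres (h_star_alg H) picH_obj (@h_bimod R H)
    (fun B A E => is_equivalence_bimodule E /\ is_covariant E)
    (@h_bimod_iso R H) (@h_bimod_comp R H) (@h_bimod_unit R H).

Definition PicH_str : groupoid_pres :=
  @GroupoidPres (h_star_alg H) picH_obj (@h_bimod R H)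
    (fun B A E => is_strong_equivalence_bimodule E /\ is_covariant E)
    (@h_bimod_iso R H) (@h_bimod_comp R H) (@h_bimod_unit R H).

End Picard.

(* Main.v *)
(* Let g act on V ⊗ H by lam g (v ⊗ h) = g1 v ⊗ g2 h. All structures of the crossed
   products are then given by
     (b ⊗ g) t = b (lam g t),  (x ⊗ g) s = x (lam g s),
     (a ⊗ g)^* = lam g^* (a^* ⊗ 1),  <x ⊗ g, y ⊗ h>_r = lam g^* (<x, y> ⊗ h),
     <x ⊗ g, y ⊗ h>_l = T (g h^* ) with T k = <x, S(k1)^* y> ⊗ k2,
   so that every identity reduces to the equivariance of the products, of the
   form lam g (u t) = (g1 u) (lam g2 t), and to a cancellation of the antipode.

   A nondegenerate bimodule is determined by the Gram matrix of a generating
   family and by the left action on it. Hence units, isomorphisms and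
   compositions can be compared on generators; for the composition these are
   (y ⊗ x) ⊗ g and (y ⊗ 1) ⊗ (x ⊗ g), the latter generating since
   (y b ⊗ k) ⊗ t = (y ⊗ 1) ⊗ (b ⊗ k) t and F = F B.

   For complete positivity, a positive functional on matrices over the crossed
   product is pulled back along a ↦ lam g_k^* (a_kl ⊗ g_l) to a positive functional
   on (larger) matrices over the algebra. *)

From mathcomp Require Import all_boot all_order all_algebra.
From mathcomp Require Import boolp classical_sets complex.
Require Import Defs.

Set Implicit Arguments.
Unset Strict Implicit.
Unset Printing Implicit Defensive.

Import Order.TTheory GRing.Theory Num.Theory.

Local Open Scope ring_scope.
Local Open Scope classical_set_scope.

(** * Semilinear maps *)

(** Unless [A] is unital, [crossed A] need not contain elements 1 ⊗ k. The operator [lam k] stands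
    in for left multiplication by such an element, which explains the shape of most identities
    below. The obstacle is that on the tensor product over the scalars the two inner products are
    compatible only up to degenerate vectors, while an equivalence bimodule must be nondegenerate.
    Hence everything is proved for [pre_equivalence], a notion that survives quotients. Fullness and
    nondegeneracy of the coefficient algebras then force the adjointness relations and the equality
    of the two degeneracy spaces; this is where nondegeneracy of the crossed products enters. For
    complete positivity the right inner product has the required shape on vectors x ⊗ g; for the
    left one, vectors are first rewritten through [lam] applied to vectors x ⊗ 1, at the cost of an
    inverse antipode. *)

Section Conjugation.
Variable R : realDomainType.
Implicit Types c d : Cx R.

Lemma conjK : involutive (@conj R).
Proof. by case=> a b; rewrite /conj /= opprK. Qed.

Lemma conj1 : conj (1 : Cx R) = 1.
Proof. by congr Complex; rewrite /= oppr0. Qed.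

Definition sconj (s : bool) c := if s then conj c else c.

Lemma sconj1 s : sconj s 1 = 1.
Proof. by case: s => //=; exact: conj1. Qed.

Lemma sconj_addb s t c : sconj s (sconj t c) = sconj (s (+) t) c.
Proof. by case: s t => [] [] //=; rewrite conjK. Qed.

End Conjugation.

(* [slin false] is [linear] and [slin true] is [antilinear], up to conversion *)
Class slin (R : realDomainType) (s : bool) (U V : lmodType (Cx R)) (f : U -> V) :=
  slinP : forall c u v, f (c *: u + v) = sconj s c *: f u + f v.

Class bislin (R : realDomainType) (s t : bool) (U V W : lmodType (Cx R))
    (op : U -> V -> W) : Prop := Bislin {
  bislinl : forall v, slin s (op^~ v);
  bislinr : forall u, slin t (op u) }.

Arguments bislinl {R s t U V W op} _ v.
Arguments bislinr {R s t U V W op} _ u.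



(* Transparent aliases of the classes, for premises that should become subgoals
   instead of being solved by class resolution *)
Definition ulin (R : realDomainType) (s : bool) (U V : lmodType (Cx R))
  (f : U -> V) : Prop := slin s f.

Definition blin (R : realDomainType) (s : bool) (U V W : lmodType (Cx R))
  (op : U -> V -> W) : Prop := bislin s s op.

Section Semilinear.
Variable R : realDomainType.
Implicit Types (U V W M N P : lmodType (Cx R)) (s r : bool).

Section Laws.
Variables (s : bool) (U V : lmodType (Cx R)) (f : U -> V).
Context {fL : slin s f}.

Lemma slinD : {morph f : u v / u + v}.
Proof. by move=> u v; have := fL 1 u v; rewrite sconj1 !scale1r. Qed.

Lemma slin0 : f 0 = 0.
Proof. by apply: (@addrI _ (f 0)); rewrite -slinD !addr0. Qed.

Lemma slinZ c u : f (c *: u) = sconj s c *: f u.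
Proof. by have := fL c u 0; rewrite slin0 !addr0. Qed.

Lemma slinN u : f (- u) = - f u.
Proof. by apply: (@addrI _ (f u)); rewrite -slinD !subrr slin0. Qed.

Lemma slinB : {morph f : u v / u - v}.
Proof. by move=> u v; rewrite slinD slinN. Qed.

Lemma slin_sum (I : Type) (r : seq I) (P : pred I) (F : I -> U) :
  f (\sum_(i <- r | P i) F i) = \sum_(i <- r | P i) f (F i).
Proof. exact: (big_morph f slinD slin0). Qed.

Lemma slin_tlift M N (F : M -> N -> U) t :
  f (tlift F t) = \tsum_(x, y <- t) f (F x y).
Proof. exact: slin_sum. Qed.

End Laws.

Lemma slin_id U : slin false (fun u : U => u).
Proof. by []. Qed.

(** Degrees of semilinearity add modulo 2. The degree of the inner map is computed from the other
    two, since a backward search knows [s] from the goal and [r] from the head map. *)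
Lemma slin_comp s r U V W (g : V -> W) (f : U -> V) :
  slin r g -> slin (s (+) r) f -> slin s (fun x => g (f x)).
Proof.
move=> gL fL c u v; rewrite fL gL sconj_addb.
by rewrite addbC addbK.
Qed.

Lemma slin_eq s U V (f g : U -> V) : (forall u, f u = g u) ->
  ulin s g -> slin s f.
Proof. by rewrite /ulin => fg gL c u v; rewrite !fg gL. Qed.

Lemma slin_big s U V (I : Type) (r : seq I) (F : U -> I -> V) :
  (forall i, slin s (F^~ i)) -> slin s (fun u => \sum_(i <- r) F u i).
Proof.
move=> FL c u v; rewrite scaler_sumr -big_split /=.
by apply: eq_bigr => i _; rewrite (FL i).
Qed.

Lemma slin_sub s U V (f g : U -> V) :
  ulin s f -> ulin s g -> slin s (fun u => f u - g u).
Proof.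
by rewrite /ulin => fL gL c u v; rewrite fL gL scalerBr opprD addrACA.
Qed.

Lemma slin_tlift_arg s U V M N (F : U -> M -> N -> V) t :
  (forall x y, slin s (fun u => F u x y)) ->
  slin s (fun u => \tsum_(x, y <- t) F u x y).
Proof. by move=> FL; apply: slin_big => -[x y] /=; apply: FL. Qed.

(** Equal degrees in both arguments are essential: with mixed degrees a scalar would come out
    conjugated on one side only. *)
Lemma bislin_balanced s M N P (f : M -> N -> P) : bislin s s f -> balanced f.
Proof.
case=> fl fr; split=> [x x' y|x y y'|c x y].
- exact: (slinD (fL := fl y)).
- exact: (slinD (fL := fr x)).
- by rewrite (slinZ (fL := fl y)) (slinZ (fL := fr x)).
Qed.

Lemma tlift_pure s M N P (f : M -> N -> P) x y :
  blin s f -> tlift f (x ⊗ y) = f x y.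
Proof. by move=> fL; apply: tlift_tens; apply: bislin_balanced fL. Qed.

Lemma tens_bislin M N : bislin false false (@tens (Cx R) M N).
Proof.
by split=> [v c x y|u c x y] /=; rewrite (tensDl, tensDr) (tensZl, tensZr).
Qed.

Lemma tensor_ind M N (Q : tensor M N -> Prop) :
  Q 0 -> (forall t u, Q t -> Q u -> Q (t + u)) -> (forall x y, Q (x ⊗ y)) ->
  forall t, Q t.
Proof. by move=> Q0 QD Qt t; rewrite [t]tensor_sum; elim/big_ind: _. Qed.

Lemma slin_tlift_tensor s M N P (f : M -> N -> P) :
  bislin s s f -> slin s (tlift f).
Proof.
move=> fL c u v; have fB := bislin_balanced fL.
rewrite tliftD //; congr (_ + _).
rewrite {1}[u]tensor_sum scaler_sumr.
rewrite (big_morph (tlift f) (tliftD fB) (id1 := 0)).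
  rewrite /tlift /evalt scaler_sumr; apply: eq_bigr => p _.
  rewrite -tensZl -[RHS](slinZ (fL := bislinl fL p.2)); exact: tlift_tens.
by apply: (@addrI _ (tlift f 0)); rewrite -tliftD // !addr0.
Qed.

Lemma tensor_ext s M N P (f g : tensor M N -> P) :
  ulin s f -> ulin s g -> (forall x y, f (x ⊗ y) = g (x ⊗ y)) -> f =1 g.
Proof.
rewrite /ulin => fL gL fg t; elim/tensor_ind: t => // [|t u ft fu].
  by rewrite (slin0 (fL := fL)) (slin0 (fL := gL)).
by rewrite (slinD (fL := fL)) (slinD (fL := gL)) ft fu.
Qed.

Lemma eq_tlift M N P (F G : M -> N -> P) t :
  (forall x y, F x y = G x y) -> tlift F t = tlift G t.
Proof. by move=> FG; apply: eq_bigr => p _. Qed.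

Lemma exchange_tlift M N M' N' P (F : M -> N -> M' -> N' -> P) t t' :
  \tsum_(x, y <- t) \tsum_(x', y' <- t') F x y x' y' =
  \tsum_(x', y' <- t') \tsum_(x, y <- t) F x y x' y'.
Proof. exact: exchange_big. Qed.

Lemma tliftB M N P (F G : M -> N -> P) t :
  \tsum_(x, y <- t) (F x y - G x y) =
  \tsum_(x, y <- t) F x y - \tsum_(x, y <- t) G x y.
Proof. exact: sumrB. Qed.

Lemma tlift_eq0 M N P (F : M -> N -> P) t :
  (forall x y, F x y = 0) -> tlift F t = 0.
Proof. by move=> F0; apply: big1. Qed.

Lemma bislin_scale V : bislin false false (fun (c : (Cx R)^o) (v : V) => c *: v).
Proof.
split=> [v c x y|u c x y] /=; first by rewrite scalerDl -scalerA.
by rewrite scalerDr !scalerA mulrC.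
Qed.

Lemma slin_scale c V : slin false (fun v : V => c *: v).
Proof. exact: bislinr (bislin_scale V) c. Qed.

Lemma bislin_mul (A : algType (Cx R)) : bislin false false (@GRing.mul A).
Proof.
split=> [v c x y|u c x y] /=; first by rewrite mulrDl scalerAl.
by rewrite mulrDr scalerAr.
Qed.

Lemma slin_mull (A : algType (Cx R)) (a : A) : slin false (GRing.mul a).
Proof. exact: bislinr (bislin_mul A) a. Qed.

Lemma bislin_of_bilinear U V W (f : U -> V -> W) :
  bilinear f -> bislin false false f.
Proof. by case=> fr fl; split. Qed.

Lemma bislin_of_sesquilinear U V W (f : U -> V -> W) :
  sesquilinear f -> bislin true false f.
Proof. by case=> fr fl; split. Qed.

Lemma bilinear_of_bislin U V W (f : U -> V -> W) :
  bislin false false f -> bilinear f.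
Proof. by case=> fl fr; split. Qed.

Lemma sesquilinear_of_bislin U V W (f : U -> V -> W) :
  bislin true false f -> sesquilinear f.
Proof. by case=> fl fr; split. Qed.

End Semilinear.

(* Without these modes the search for an unknown operator does not terminate *)
#[global] Hint Mode slin - - - - ! : typeclass_instances.
#[global] Hint Mode bislin - - - - - - ! : typeclass_instances.
#[global] Existing Instance tens_bislin.
#[global] Existing Instance bislin_mul.
#[global] Existing Instance slin_scale.
#[global] Existing Instance slin_mull.
#[global] Existing Instance bislinr.

Ltac slin_head := first [ assumption | typeclasses eauto ].
(* In the patterns below [slin_var] is also a fresh name: a pattern variable that
   captures it makes the branch fail, so that only closed heads are accepted.
   The sort of [t] in [tlift G (t x)] is guessed, since it determines that of [G] *)
Ltac slin_step :=
  lazymatch goal with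
  | |- slin ?s (fun x => x) => unify s false; exact: slin_id
  | |- slin _ _ => slin_app
  end
with slin_app :=
  match goal with
  | |- slin ?s (fun x => tlift (@?F x) (@?t x)) =>
      lazymatch t with
      | fun _ => ?c => notypeclasses refine (slin_tlift_arg _ _); intros ? ?
      | _ => lazymatch F with fun _ => ?G =>
          lazymatch t with
          | fun y => y => idtac
          | _ => let comp r :=
                   notypeclasses refine (@slin_comp _ _ r _ _ _ (tlift G) t _ _);
                   [ | solve [slin] ] in
                 let s' := eval cbn in (negb s) in
                 first [ comp s | comp s' ]
          end;
          notypeclasses refine (@slin_tlift_tensor _ _ _ _ _ G _);
          split; intro end
      end
  | |- slin _ (tlift _) =>
      notypeclasses refine (slin_tlift_tensor _); split; intro
  | |- slin _ (fun slin_var => ?g (@?e slin_var)) =>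
      notypeclasses refine (@slin_comp _ _ _ _ _ _ g e _ _);
      [ slin_head | ]
  | |- slin _ (fun slin_var => ?op (@?e slin_var) ?b) =>
      notypeclasses refine (@slin_comp _ _ _ _ _ _ (fun u => op u b) e _ _);
      [ notypeclasses refine (bislinl _ _); slin_head | ]
  | |- slin _ _ => slin_head
  end; cbn [addb]; rewrite ?addbb ?addbF
with slin := cbv beta delta [ulin]; repeat (slin_step; cbn beta).
Ltac bislin := split; intro; slin.
Ltac tensor_ext_as s t := move: t; refine (tensor_ext (s := s) _ _ _); [slin|slin|].
Ltac tensor_ext t := tensor_ext_as false t.

(** * Sweedler calculus *)

Record trislin (R : realDomainType) (s : bool) (U V W X : lmodType (Cx R))
    (F : U -> V -> W -> X) : Prop := Trislin {
  trislin1 : forall v w, slin s (fun u => F u v w);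
  trislin2 : forall u w, slin s (fun v => F u v w);
  trislin3 : forall u v, slin s (F u v) }.

Ltac trislin := split=> ? ?; slin.

Section Sweedler.
Variables (R : realDomainType) (H : hopf_star_alg R).
Implicit Types (g h k : H) (V : lmodType (Cx R)) (s : bool).

Local Notation S := (@antipode R H).
Local Notation Sinv := (@antipode_inv R H).
Local Notation hstar := (@hstar R H).

#[export] Instance Delta_slin : slin false (@Delta R H).
Proof. exact: Delta_linear. Qed.

#[export] Instance antipode_slin : slin false S.
Proof. exact: antipode_linear. Qed.

#[export] Instance hstar_slin : slin true hstar.
Proof. exact: hstar_antilinear. Qed.

#[export] Instance antipode_inv_slin : slin false Sinv.
Proof. by change (slin false (fun g => hstar (S (hstar g)))); slin. Qed.

(** A summand of one common degree in its three arguments factors through the nested tensor product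
    in which [coassociative] is stated. This is the rebracketing rule of Sweedler notation. *)
Lemma tsum_coassoc s V (F : H -> H -> H -> V) g : trislin s F ->
  \tsum_(g12, g3 <- Delta g) \tsum_(g1, g2 <- Delta g12) F g1 g2 g3 =
  \tsum_(g1, g23 <- Delta g) \tsum_(g2, g3 <- Delta g23) F g1 g2 g3.
Proof.
case=> F1 F2 F3.
pose G := tlift (fun g1 => tlift (F g1)).
have FB g1 : bislin s s (F g1) by split=> ?; [exact: F2|exact: F3].
have GB : bislin s s (fun g1 => tlift (F g1)).
  split=> [t|g1]; last exact: slin_tlift_tensor.
  by apply: slin_tlift_arg => ? ?; exact: F1.
have GL : slin s G by exact: slin_tlift_tensor.
have := congr1 G (coassociative g); rewrite !(slin_tlift (fL := GL)).
under eq_tlift => x y.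
  rewrite (slin_tlift (fL := GL)).
  under eq_tlift do rewrite /G (tlift_pure _ _ GB) (tlift_pure _ _ (FB _)).
over.
under [in RHS]eq_tlift => x y.
  rewrite (slin_tlift (fL := GL)).
  under eq_tlift do rewrite /G (tlift_pure _ _ GB) (tlift_pure _ _ (FB _)).
over.
by [].
Qed.

Lemma tsum_counitl s V (f : H -> V) g : ulin s f ->
  \tsum_(g1, g2 <- Delta g) sconj s (eps g1) *: f g2 = f g.
Proof.
rewrite /ulin => fL; rewrite -[in RHS](counitl g) (slin_tlift (fL := fL)).
by apply: eq_tlift => x y; rewrite (slinZ (fL := fL)).
Qed.

Lemma tsum_counitr s V (f : H -> V) g : ulin s f ->
  \tsum_(g1, g2 <- Delta g) sconj s (eps g2) *: f g1 = f g.
Proof.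
rewrite /ulin => fL; rewrite -[in RHS](counitr g) (slin_tlift (fL := fL)).
by apply: eq_tlift => x y; rewrite (slinZ (fL := fL)).
Qed.

Lemma tsum_Delta1 s V (F : H -> H -> V) : blin s F ->
  tlift F (Delta 1) = F 1 1.
Proof. by move=> FB; rewrite Delta1 (tlift_pure _ _ FB). Qed.

Lemma tsum_DeltaM s V (F : H -> H -> V) g h : blin s F ->
  tlift F (Delta (g * h)) =
  \tsum_(g1, g2 <- Delta g) \tsum_(h1, h2 <- Delta h) F (g1 * h1) (g2 * h2).
Proof.
rewrite /blin => FB; have FL := slin_tlift_tensor FB.
rewrite DeltaM (slin_tlift (fL := FL)); apply: eq_tlift => x y.
rewrite (slin_tlift (fL := FL)); apply: eq_tlift => z t.
by rewrite (tlift_pure _ _ FB).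
Qed.

Lemma tsum_Delta_star s V (F : H -> H -> V) g : blin s F ->
  tlift F (Delta (hstar g)) =
  \tsum_(g1, g2 <- Delta g) F (hstar g1) (hstar g2).
Proof.
rewrite /blin => FB; have FL := slin_tlift_tensor FB.
rewrite Delta_star (slin_tlift (fL := FL)); apply: eq_tlift => x y.
by rewrite (tlift_pure _ _ FB).
Qed.

Section Cancellation.
Variable c : H -> H -> H.
Hypothesis cB : bislin false false c.
Hypothesis c_eps : forall g, tlift c (Delta g) = (eps g)%:A.

(** The map [c] will be one of [S x * y], [x * S y] and [y * Sinv x]. Coassociativity brings the
    first two legs together, [c_eps] turns them into a counit, and the counit is absorbed by the
    remaining leg. *)
Lemma tsum_cancel_head s V (F : H -> H -> V) g : blin s F ->
  \tsum_(g1, g23 <- Delta g) \tsum_(g2, g3 <- Delta g23) F (c g1 g2) g3 = F 1 g.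
Proof.
rewrite /blin => FB; rewrite -(tsum_coassoc (s := s)); last by trislin.
rewrite -[RHS](tsum_counitl g (bislinr FB 1 : ulin s _)); apply: eq_tlift => x y.
rewrite -(slinZ (fL := bislinl FB y)) -c_eps.
by rewrite (slin_tlift (fL := bislinl FB y)).
Qed.

Lemma tsum_cancel_tail s V (F : H -> H -> V) g : blin s F ->
  \tsum_(g1, g23 <- Delta g) \tsum_(g2, g3 <- Delta g23) F g1 (c g2 g3) = F g 1.
Proof.
rewrite /blin => FB; rewrite -[RHS](tsum_counitr g (bislinl FB 1 : ulin s _)).
apply: eq_tlift => x y.
rewrite -(slinZ (fL := bislinr FB x)) -c_eps.
by rewrite (slin_tlift (fL := bislinr FB x)).
Qed.

End Cancellation.

(** Both sides are convolution inverses of the multiplication on H ⊗ H. The sum [X] is their triple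
    convolution product with the multiplication in the middle, evaluated in its two bracketings. *)
Lemma antipode_mul g h : S (g * h) = S h * S g.
Proof.
pose mS (x y : H) := x * S y.
have mSB : bislin false false mS by rewrite /mS; bislin.
have mSe k : tlift mS (Delta k) = (eps k)%:A by exact: antipoder.
pose X : H := \tsum_(g1, b <- Delta g) \tsum_(g2, g3 <- Delta b)
  \tsum_(h1, d <- Delta h) \tsum_(h2, h3 <- Delta d)
  S (g1 * h1) * (g2 * mS h2 h3 * S g3).
(* From the right: [h2 * S h3] collapses first, and this leaves [g2 * S g3] to collapse. *)
have: X = S (g * h).
  rewrite /X.
  under eq_tlift => g1 b.
    under eq_tlift => g2 g3.
      rewrite (@tsum_cancel_tail mS mSe false _
        (fun u w => S (g1 * u) * (g2 * w * S g3))); last by bislin.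
      rewrite mulr1 -[g2 * S g3]/(mS g2 g3).
    over.
  over.
  rewrite (@tsum_cancel_tail mS mSe false _ (fun u w => S (u * h) * w)).
    by rewrite mulr1.
  by bislin.
(* From the left: after rebracketing both coproducts, [S (g1 * h1) * (g2 * h2)] is the antipode
   axiom for a product and gives its counit. *)
move=> <-; rewrite /X -(tsum_coassoc (s := false)
    (F := fun g1 g2 g3 => \tsum_(h1, d <- Delta h) \tsum_(h2, h3 <- Delta d)
  S (g1 * h1) * (g2 * mS h2 h3 * S g3))); last by (rewrite /mS; trislin).
rewrite -[RHS](tsum_counitl (s := false) (f := fun x => S h * S x)); last by slin.
apply: eq_tlift => a g3 /=.
under eq_tlift => g1 g2.
  rewrite -(tsum_coassoc (s := false)
    (F := fun h1 h2 h3 => S (g1 * h1) * (g2 * mS h2 h3 * S g3))).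
over.
  by rewrite /mS; trislin.
rewrite exchange_tlift.
have := tsum_counitl h (s := false) (f := fun x => S x * S g3).
move=> <- /=; last by slin.
rewrite (slin_tlift (f := fun v : H => eps a *: v)).
apply: eq_tlift => e h3 /=.
transitivity (\tsum_(x, y <- Delta (a * e)) S x * y * (S h3 * S g3)).
  rewrite (tsum_DeltaM (s := false)); last by bislin.
  by do 2![apply: eq_tlift => ? ?]; rewrite /mS !mulrA.
rewrite -(slin_tlift (fL := bislinl _ (S h3 * S g3))) antipodel epsM /=.
by rewrite -!scalerAl mul1r scalerA.
Qed.

Lemma antipode1 : S 1 = 1.
Proof.
have := antipodel (1 : H); rewrite (tsum_Delta1 (s := false)); last by bislin.
by rewrite mulr1 eps1 scale1r.
Qed.

Lemma hstar1 : hstar 1 = 1.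
Proof. by rewrite -[LHS]mulr1 -[X in _ * X]hstarK -hstarM mulr1 hstarK. Qed.

(** [S] is injective and reverses products, so applying it turns the summand into [g1 * S g2]. *)
Lemma mSinvr_eps g : \tsum_(g1, g2 <- Delta g) g2 * Sinv g1 = (eps g)%:A.
Proof.
apply: (can_inj (@antipodeK R H)).
rewrite (slin_tlift (f := S)) (slinZ (f := S)) antipode1 /= -antipoder.
by apply: eq_tlift => x y; rewrite antipode_mul antipode_invK.
Qed.

Lemma tsum_Sl s V (F : H -> H -> V) g : blin s F ->
  \tsum_(g1, g23 <- Delta g) \tsum_(g2, g3 <- Delta g23) F (S g1 * g2) g3 = F 1 g.
Proof.
by apply: (@tsum_cancel_head (fun x y => S x * y)) => [|?];
  [bislin|apply: antipodel].
Qed.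

Lemma tsum_Sr s V (F : H -> H -> V) g : blin s F ->
  \tsum_(g1, g23 <- Delta g) \tsum_(g2, g3 <- Delta g23) F (g1 * S g2) g3 = F 1 g.
Proof.
by apply: (@tsum_cancel_head (fun x y => x * S y)) => [|?];
  [bislin|apply: antipoder].
Qed.

Lemma tsum_tailSr s V (F : H -> H -> V) g : blin s F ->
  \tsum_(g1, g23 <- Delta g) \tsum_(g2, g3 <- Delta g23) F g1 (g2 * S g3) = F g 1.
Proof.
exact: (@tsum_cancel_tail (fun x y => x * S y) (@antipoder R H)).
Qed.

Lemma tsum_Sinvr s V (F : H -> H -> V) g : blin s F ->
  \tsum_(g1, g23 <- Delta g) \tsum_(g2, g3 <- Delta g23) F (g2 * Sinv g1) g3 = F 1 g.
Proof.
by apply: (@tsum_cancel_head (fun x y => y * Sinv x)) => [|?];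
  [bislin|apply: mSinvr_eps].
Qed.

End Sweedler.

Existing Class is_h_module.
Existing Class is_star_action.

(** * Crossed products of modules and of bilinear maps *)

Section LeftMap.
Variables (R : realDomainType) (H : hopf_star_alg R).
Implicit Types (U V W : lmodType (Cx R)).

(** The second factor is a spectator. The degree in [u] stays free, because [m] will also be an
    inner product, antilinear in [u]. *)
Definition lmap U V W (m : U -> V -> W) u (t : tensor V H) : tensor W H :=
  \tsum_(v, h <- t) m u v ⊗ h.

Lemma lmap_tens s U V W (m : U -> V -> W) u v h : bislin s false m ->
  lmap m u (v ⊗ h) = m u v ⊗ h.
Proof. by move=> mB; apply: (tlift_pure (s := false)); bislin. Qed.

#[export] Instance lmap_bislin s U V W (m : U -> V -> W) :
  bislin s false m -> bislin s false (lmap m).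
Proof. by move=> mB; rewrite /lmap; bislin. Qed.

End LeftMap.

Section HModule.
Variables (R : realDomainType) (H : hopf_star_alg R).
Variables (V : lmodType (Cx R)) (act : H -> V -> V).
Context {hV : is_h_module act}.
Implicit Types (g h k : H) (v : V) (t : tensor V H).

#[export] Instance act_bislin : bislin false false act.
Proof. exact: bislin_of_bilinear (hm_bilinear hV). Qed.

Definition lam k t : tensor V H :=
  \tsum_(v, h <- t) \tsum_(k1, k2 <- Delta k) act k1 v ⊗ (k2 * h).


#[export] Instance lam_bislin : bislin false false lam.
Proof. by rewrite /lam; bislin. Qed.

Lemma lam_tens k v h :
  lam k (v ⊗ h) = \tsum_(k1, k2 <- Delta k) act k1 v ⊗ (k2 * h).
Proof. by rewrite [LHS](tlift_pure (s := false)) //; bislin. Qed.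

Lemma lam_mul g k t : lam (g * k) t = lam g (lam k t).
Proof.
tensor_ext t => v h.
rewrite !lam_tens (tsum_DeltaM (s := false)); last by bislin.
rewrite (slin_tlift (f := lam g)).
under [RHS]eq_tlift do rewrite lam_tens.
rewrite exchange_tlift.
by do 2![apply: eq_tlift => ? ?]; rewrite (hm_mul hV) mulrA.
Qed.

Lemma lam1 t : lam 1 t = t.
Proof.
tensor_ext t => v h.
rewrite lam_tens (tsum_Delta1 (s := false)); last by bislin.
by rewrite (hm_one hV) mul1r.
Qed.

End HModule.

Definition equivariant (R : realDomainType) (H : hopf_star_alg R)
    (U V W : lmodType (Cx R)) (actU : H -> U -> U) (actV : H -> V -> V)
    (actW : H -> W -> W) (m : U -> V -> W) : Prop :=
  forall g u v, actW g (m u v) =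
    \tsum_(g1, g2 <- Delta g) m (actU g1 u) (actV g2 v).

Section CrossedMap.
Variables (R : realDomainType) (H : hopf_star_alg R).
Implicit Types (g h k : H).

(* All three products of a crossed product are of this form, and by [xmap_tensl]
   (u ⊗ g) t = u (g t), with g acting on t by [lam] *)
Definition xmap (U V W : lmodType (Cx R)) (actV : H -> V -> V)
    (m : U -> V -> W) (t : tensor U H) (u : tensor V H) : tensor W H :=
  \tsum_(a, g <- t) \tsum_(b, h <- u) \tsum_(g1, g2 <- Delta g)
    m a (actV g1 b) ⊗ (g2 * h).

Section One.
Variables (U V W : lmodType (Cx R)) (actV : H -> V -> V).
Context {hV : is_h_module actV}.
Variable m : U -> V -> W.
Context {mB : bislin false false m}.

Lemma xmapE t u : xmap actV m t u =
  \tsum_(a, g <- t) lmap m a (lam actV g u).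
Proof.
apply: eq_tlift => a g; rewrite /lam (slin_tlift (f := lmap m a)).
apply: eq_tlift => b h; rewrite (slin_tlift (f := lmap m a)).
by apply: eq_tlift => ? ?; rewrite lmap_tens.
Qed.

#[export] Instance xmap_bislin : bislin false false (xmap actV m).
Proof. by rewrite /xmap; bislin. Qed.

Lemma xmap_tensl a g u : xmap actV m (a ⊗ g) u = lmap m a (lam actV g u).
Proof.
by rewrite xmapE (tlift_pure (s := false)) //; rewrite /lmap /lam; bislin.
Qed.

Lemma xmap_tens1 a b h : xmap actV m (a ⊗ 1) (b ⊗ h) = m a b ⊗ h.
Proof. by rewrite xmap_tensl lam1 // lmap_tens. Qed.

Lemma xmap_tens a g b h : xmap actV m (a ⊗ g) (b ⊗ h) =
  \tsum_(g1, g2 <- Delta g) m a (actV g1 b) ⊗ (g2 * h).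
Proof.
rewrite xmap_tensl lam_tens // (slin_tlift (f := lmap m a)).
by apply: eq_tlift => ? ?; rewrite lmap_tens.
Qed.

Variables (actU : H -> U -> U) (actW : H -> W -> W).
Context {hU : is_h_module actU} {hW : is_h_module actW}.
Hypothesis mE : equivariant actU actV actW m.

(** Coassociativity: the first two legs are those of the equivariance of [m], and the third
    multiplies the factor in [H]. *)
Lemma lam_lmap g u t : lam actW g (lmap m u t) =
  \tsum_(g1, g2 <- Delta g) lmap m (actU g1 u) (lam actV g2 t).
Proof.
tensor_ext t => v h.
rewrite lmap_tens !lam_tens //.
under [LHS]eq_tlift => x y do rewrite mE.
under [RHS]eq_tlift => x y.
  rewrite lam_tens // (slin_tlift (f := lmap m _)).
  under eq_tlift => ? ? do rewrite lmap_tens.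
over.
rewrite -(tsum_coassoc (s := false)
  (F := fun x y z => m (actU x u) (actV y v) ⊗ (z * h))); last by trislin.
by apply: eq_tlift => x y; rewrite (slin_tlift (f := fun w => w ⊗ (y * h))
  (fL := bislinl _ _)).
Qed.

(** Formally this is associativity with a first factor 1 ⊗ k, whose left multiplication is
    [lam k]. *)
Lemma lam_xmap k t u :
  lam actW k (xmap actV m t u) = xmap actV m (lam actU k t) u.
Proof.
tensor_ext t => a g.
rewrite xmap_tensl lam_lmap lam_tens //.
rewrite (slin_tlift (f := fun t => xmap actV m t u) (fL := bislinl _ _)).
by apply: eq_tlift => x y; rewrite xmap_tensl lam_mul.
Qed.

End One.

Section Associativity.
Variables (U V W X Y Z : lmodType (Cx R)).
Variables (actV : H -> V -> V) (actX : H -> X -> X) (actY : H -> Y -> Y).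
Context {hV : is_h_module actV} {hX : is_h_module actX}.
Context {hY : is_h_module actY}.
Variables (m : U -> V -> W) (n : W -> X -> Z) (m' : V -> X -> Y)
  (n' : U -> Y -> Z).
Context {mB : bislin false false m} {nB : bislin false false n}.
Context {m'B : bislin false false m'} {n'B : bislin false false n'}.
Hypothesis m'E : equivariant actV actX actY m'.
Hypothesis mnA : forall u v x, n (m u v) x = n' u (m' v x).

(** Four laws are instances: associativity of the crossed product algebra, the two module laws, and
    the commutation of the left with the right action. *)
Lemma xmapA t u w :
  xmap actX n (xmap actV m t u) w = xmap actY n' t (xmap actX m' u w).
Proof.
tensor_ext t => a g.
rewrite !xmap_tensl (lam_xmap m'E).
move: (lam actV g u) => {}u; tensor_ext u => b h.
rewrite lmap_tens !xmap_tensl // .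
move: (lam actX h w) => {}w; tensor_ext w => x k.
by rewrite /= !lmap_tens // mnA.
Qed.

End Associativity.
End CrossedMap.

(** * Equivalence bimodules up to degeneracy *)

Existing Class is_star_alg.
Existing Class is_equivalence_bimodule.

Section SpanMaps.
Variables (R : realDomainType).
Implicit Types U V : lmodType (Cx R).

Lemma span_big U (S : set U) (I : Type) (r : seq I) (F : I -> U) :
  (forall i, span S (F i)) -> span S (\sum_(i <- r) F i).
Proof. by move=> SF; elim/big_ind: _ => //; [exact: span0|exact: spanD]. Qed.

Lemma span_tlift U (S : set U) (M N : lmodType (Cx R)) (F : M -> N -> U) t :
  (forall x y, span S (F x y)) -> span S (tlift F t).
Proof. by move=> SF; apply: span_big => p; apply: SF. Qed.

Lemma span_map U V (f : U -> V) (S : set U) (T : set V) :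
  slin false f -> (forall x, S x -> span T (f x)) ->
  forall x, span S x -> span T (f x).
Proof.
move=> fL fST _ [s sS ->]; rewrite (slin_sum (f := f)) big_seq.
elim/big_ind: _ => [||p /sS Sp]; [exact: span0|exact: spanD|].
by rewrite (slinZ (f := f)); apply/spanZ/fST.
Qed.

Lemma span_map0 s U V (f : U -> V) (S : set U) :
  slin s f -> (forall x, S x -> f x = 0) -> forall x, span S x -> f x = 0.
Proof.
move=> fL fS _ [r rS ->]; rewrite (slin_sum (f := f)) big_seq.
by apply: big1 => p /rS Sp; rewrite (slinZ (f := f)) fS // scaler0.
Qed.

Lemma sub_span U (S T : set U) : (forall x, S x -> span T x) ->
  forall x, span S x -> span T x.
Proof. by move=> ST; apply: (@span_map _ _ id). Qed.

#[export] Instance qproj_slin U (S : set U) : slin false (qproj S).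
Proof. exact: qproj_linear. Qed.

Lemma slin_quot s U V (S : set U) (f : quotmod S -> V) :
  ulin s (fun x => f (qproj S x)) -> slin s f.
Proof.
move=> fL c; elim/qprojP=> x; elim/qprojP=> y.
by rewrite -fL (slinP (f := qproj S)).
Qed.

End SpanMaps.

Section StarAlgebraInstances.
Variables (R : realDomainType) (A : star_alg R).
Context {sA : is_star_alg A}.

#[export] Instance sa_mul_bislin : bislin false false (@sa_mul R A).
Proof. exact: bislin_of_bilinear (sa_bilinear sA). Qed.

#[export] Instance sa_star_slin : slin true (@sa_star R A).
Proof. exact: sa_antilinear sA. Qed.

Lemma sa_mul0 (a : A) : a ·m 0 = 0.
Proof. exact: (slin0 (f := sa_mul a)). Qed.

End StarAlgebraInstances.

Section PreEquivalence.
Variables (R : realDomainType) (B A : star_alg R).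

(* An equivalence bimodule before its degeneracy space is divided out: the two
   inner products are compatible only as far as they can detect it *)
Record pre_equivalence (E : bimod B A) : Prop := PreEquivalence {
  pe_lact : bislin false false (@lact R B A E);
  pe_ract : bislin false false (@ract R B A E);
  pe_rip : bislin true false (@rip R B A E);
  pe_lip : bislin false true (@lip R B A E);
  pe_lactA : forall (b c : B) (x : E), (b ·m c) ·l x = b ·l (c ·l x);
  pe_ractA : forall (x : E) (a c : A), x ·r (a ·m c) = (x ·r a) ·r c;
  pe_lractA : forall (b : B) (x : E) (a : A), (b ·l x) ·r a = b ·l (x ·r a);
  pe_lact_full : forall z : E,
    span [set y | exists (b : B) (x : E), y = b ·l x] z;
  pe_ract_full : forall z : E,
    span [set y | exists (x : E) (a : A), y = x ·r a] z;
  pe_rip_ract : forall (x y : E) (a : A), ⟨x, y ·r a⟩r = ⟨x, y⟩r ·m a;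
  pe_rip_sym : forall x y : E, ⟨x, y⟩r = ⟨y, x⟩r^★;
  pe_rip_full : forall a : A, span [set c | exists x y : E, c = ⟨x, y⟩r] a;
  pe_lip_lact : forall (b : B) (x y : E), ⟨b ·l x, y⟩l = b ·m ⟨x, y⟩l;
  pe_lip_sym : forall x y : E, ⟨x, y⟩l = ⟨y, x⟩l^★;
  pe_lip_full : forall b : B, span [set c | exists x y : E, c = ⟨x, y⟩l] b;
  pe_rip_lip_rip : forall w x y z : E,
    ⟨w, ⟨x, y⟩l ·l z⟩r = ⟨w, x ·r ⟨y, z⟩r⟩r;
  pe_lip_lip_rip : forall x y z w : E,
    ⟨⟨x, y⟩l ·l z, w⟩l = ⟨x ·r ⟨y, z⟩r, w⟩l }.

Lemma pre_equivalence_of (E : bimod B A) :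
  is_equivalence_bimodule E -> pre_equivalence E.
Proof.
case=> -[? ? ? ? ? _ _] ? ? ? ? ? _ ? lipS ? ? _ ? _ _ lr; split=> //.
- exact: bislin_of_bilinear.
- exact: bislin_of_bilinear.
- exact: bislin_of_sesquilinear.
- by case: lipS.
- by move=> w x y z; rewrite lr.
- by move=> x y z w; rewrite lr.
Qed.

End PreEquivalence.
Existing Class pre_equivalence.
#[global] Existing Instance pre_equivalence_of.
#[global] Existing Instance pe_lact.
#[global] Existing Instance pe_ract.
#[global] Existing Instance pe_rip.
#[global] Existing Instance pe_lip.

Section PreEquivalenceTheory.
Variables (R : realDomainType) (B A : star_alg R) (E : bimod B A).
Context {sB : is_star_alg B} {sA : is_star_alg A} {hE : pre_equivalence E}.
Hypotheses (nB : nondegenerate_alg B) (nA : nondegenerate_alg A).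
Implicit Types (x y z w : E) (b c : B) (a d : A).

Lemma rip_ractl x y a : ⟨x ·r a, y⟩r = a^★ ·m ⟨x, y⟩r.
Proof.
by rewrite (pe_rip_sym hE) (pe_rip_ract hE) (sa_starM sA) -(pe_rip_sym hE).
Qed.

Lemma lip_lactr b x y : ⟨x, b ·l y⟩l = ⟨x, y⟩l ·m b^★.
Proof.
by rewrite (pe_lip_sym hE) (pe_lip_lact hE) (sa_starM sB) -(pe_lip_sym hE).
Qed.

(** By fullness the inner products span [B], so the hypothesis says that [b] annihilates [B] from
    the left. This is the test for equality of elements of [B] used throughout. *)
Lemma lip_mul0 b : (forall x y, b ·m ⟨x, y⟩l = 0) -> b = 0.
Proof.
move=> b0; apply: nB; left=> c.
apply: (span_map0 (f := sa_mul b)) (pe_lip_full hE c).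
by move=> _ [x [y ->]].
Qed.

Lemma rip_mul0 a : (forall x y, ⟨x, y⟩r ·m a = 0) -> a = 0.
Proof.
move=> a0; apply: nA; right=> c.
apply: (span_map0 (f := fun d => d ·m a) _ _ (pe_rip_full hE c)).
  by slin.
by move=> _ [x [y ->]].
Qed.

(** Multiplied on the right by a left inner product ⟨v, w⟩, both sides can be rewritten by
    [pe_lip_lip_rip]; the claim then becomes the adjointness that the right inner product has by
    sesquilinearity and symmetry. *)
Lemma pe_lip_ract x y a : ⟨x ·r a, y⟩l = ⟨x, y ·r a^★⟩l.
Proof.
apply/eqP; rewrite -subr_eq0; apply/eqP/lip_mul0 => v w.
rewrite (slinB (f := fun b => b ·m _) (fL := bislinl _ _)).
rewrite -!(pe_lip_lact hE) !(pe_lip_lip_rip hE).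
by rewrite rip_ractl (sa_starK sA) (pe_ractA hE) subrr.
Qed.

Lemma pe_rip_lact b x y : ⟨b ·l x, y⟩r = ⟨x, b^★ ·l y⟩r.
Proof.
apply/eqP; rewrite -subr_eq0; apply/eqP/rip_mul0 => v w.
rewrite (slinB (f := fun a => _ ·m a) (fL := bislinr _ _)).
rewrite -!(pe_rip_ract hE) -!(pe_rip_lip_rip hE).
by rewrite lip_lactr (pe_lactA hE) subrr.
Qed.

(** With [rip_degenerate] this identifies the two degeneracy spaces: ⟨y, x⟩ ⟨z, w⟩ on the left
    equals ⟨y ⟨x, z⟩, w⟩, where the inner ⟨x, z⟩ is the right one. *)
Lemma lip_degenerate x : (forall y, ⟨x, y⟩r = 0) -> forall y, ⟨x, y⟩l = 0.
Proof.
move=> x0 y; rewrite (pe_lip_sym hE).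
suff -> : ⟨y, x⟩l = 0 by rewrite (slin0 (f := @sa_star R _)).
apply: lip_mul0 => z w; rewrite -(pe_lip_lact hE) (pe_lip_lip_rip hE) x0.
rewrite (slin0 (f := ract y)).
exact: (slin0 (f := fun x => ⟨x, w⟩l) (fL := bislinl _ _)).
Qed.

Lemma rip_degenerate x : (forall y, ⟨x, y⟩l = 0) -> forall y, ⟨x, y⟩r = 0.
Proof.
move=> x0 y; apply: rip_mul0 => z w.
rewrite -(pe_rip_ract hE) -(pe_rip_lip_rip hE) (pe_lip_sym hE) x0.
rewrite (slin0 (f := @sa_star R _)).
rewrite (slin0 (f := fun b => b ·l y) (fL := bislinl _ _)).
exact: (slin0 (f := rip z)).
Qed.

(** The degeneracy space is already a submodule, so the span taken by [quotmod] adds nothing to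
    it. *)
Lemma span_degeneracy x : span (degeneracy E) x -> degeneracy E x.
Proof.
move=> Sx y.
by apply: (span_map0 (f := fun x => ⟨x, y⟩r) (bislinl _ _) _ Sx) => z; apply.
Qed.

Lemma degeneracy_lact b x : degeneracy E x -> degeneracy E (b ·l x).
Proof. by move=> Dx y; rewrite pe_rip_lact. Qed.

Lemma degeneracy_ract x a : degeneracy E x -> degeneracy E (x ·r a).
Proof. by move=> Dx y; rewrite rip_ractl Dx sa_mul0. Qed.

(** Identities known only under the right inner product become identities of vectors. Units act
    trivially because the module is spanned by vectors [b ·l x], resp. [x ·r a]. *)
Lemma is_equivalence_of_nondegenerate :
    (forall x, degeneracy E x -> x = 0) -> is_equivalence_bimodule E.
Proof.
move=> nE.
have rip_inj x y : (forall w, ⟨w, x⟩r = ⟨w, y⟩r) -> x = y.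
  move=> xy; apply/eqP; rewrite -subr_eq0; apply/eqP/nE => w.
  rewrite (pe_rip_sym hE) (slinB (f := rip w)) xy subrr.
  exact: (slin0 (f := @sa_star R _)).
have lU (e : B) x : is_unit e -> e ·l x = x.
  move=> eU; apply/eqP; rewrite -subr_eq0; apply/eqP.
  apply: (span_map0 (s := false) (f := fun x => e ·l x - x) _ _
    (pe_lact_full hE x)) => [c u v|_ [b [y ->]]].
    by rewrite (bislinr _ e c u v) /= scalerBr opprD addrACA.
  by rewrite -(pe_lactA hE) (eU b).1 subrr.
have rU (e : A) x : is_unit e -> x ·r e = x.
  move=> eU; apply/eqP; rewrite -subr_eq0; apply/eqP.
  apply: (span_map0 (s := false) (f := fun x => x ·r e - x) _ _
    (pe_ract_full hE x)) => [c u v|_ [y [a ->]]].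
    by rewrite (bislinl _ e c u v) /= scalerBr opprD addrACA.
  by rewrite -(pe_ractA hE) (eU a).2 subrr.
split=> //.
- split=> //; try exact: bilinear_of_bislin; try by case: hE.
- by case: hE.
- by case: hE.
- exact: sesquilinear_of_bislin.
- by case: hE.
- by case: hE.
- by case: hE.
- by case: (pe_lip hE) => lL lR; split=> ?; [exact: lL|exact: lR].
- by case: hE.
- by case: hE.
- by move=> x /rip_degenerate; apply: nE.
- by case: hE.
- exact: pe_rip_lact.
- exact: pe_lip_ract.
- by move=> x y z; apply: rip_inj => w; rewrite (pe_rip_lip_rip hE).
Qed.

Section Quotient.
Variable S : set E.
Hypothesis SD : S `<=` degeneracy E.
Hypothesis Sl : forall b x, span S x -> span S (b ·l x).
Hypothesis Sr : forall x a, span S x -> span S (x ·r a).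
Local Notation Q := (bimod_quot S).

Lemma span_sub_degeneracy x : span S x -> degeneracy E x.
Proof.
by move=> Sx; apply/span_degeneracy/(sub_span _ Sx) => y /SD; apply: span_sub.
Qed.

Lemma quot_lact b x : (b : B) ·l (qproj S x : Q) = qproj S (b ·l x).
Proof.
apply/qproj_eqP; rewrite -(slinB (f := lact b)).
exact/Sl/qreprE.
Qed.

Lemma quot_ract x a : (qproj S x : Q) ·r a = qproj S (x ·r a).
Proof.
apply/qproj_eqP; rewrite -(slinB (f := fun x => x ·r a) (fL := bislinl _ _)).
exact/Sr/qreprE.
Qed.

Lemma quot_rip x y : ⟨(qproj S x : Q), (qproj S y : Q)⟩r = ⟨x, y⟩r.
Proof.
have D z := span_sub_degeneracy (qreprE S z).
have E1 z z' : ⟨qrepr (qproj S z), z'⟩r = ⟨z, z'⟩r.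
  apply/eqP; rewrite -subr_eq0.
  by rewrite -(slinB (f := fun z => ⟨z, z'⟩r) (fL := bislinl _ _)) D.
by rewrite /= E1 (pe_rip_sym hE) E1 -(pe_rip_sym hE).
Qed.

Lemma quot_lip x y : ⟨(qproj S x : Q), (qproj S y : Q)⟩l = ⟨x, y⟩l.
Proof.
have D z := lip_degenerate (span_sub_degeneracy (qreprE S z)).
have E1 z z' : ⟨qrepr (qproj S z), z'⟩l = ⟨z, z'⟩l.
  apply/eqP; rewrite -subr_eq0.
  by rewrite -(slinB (f := fun z => ⟨z, z'⟩l) (fL := bislinl _ _)) D.
by rewrite /= E1 (pe_lip_sym hE) E1 -(pe_lip_sym hE).
Qed.

(** An arbitrary invariant [S] inside the degeneracy space is allowed because a composition takes
    two successive quotients: by the balancing relations, then by the degeneracy. *)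
Lemma quot_pre_equivalence : pre_equivalence Q.
Proof.
split.
- split=> [u|b].
    elim/qprojP: u => x; apply: slin_eq (fun b => quot_lact b x) _; slin.
  apply: slin_quot; apply: slin_eq (quot_lact b) _; slin.
- split=> [a|u].
    apply: slin_quot; apply: slin_eq (quot_ract^~ a) _; slin.
  elim/qprojP: u => x; apply: slin_eq (quot_ract x) _; slin.
- split=> [v|u].
    elim/qprojP: v => y; apply: slin_quot; apply: slin_eq (quot_rip^~ y) _; slin.
  elim/qprojP: u => x; apply: slin_quot; apply: slin_eq (quot_rip x) _; slin.
- split=> [v|u].
    elim/qprojP: v => y; apply: slin_quot; apply: slin_eq (quot_lip^~ y) _; slin.
  elim/qprojP: u => x; apply: slin_quot; apply: slin_eq (quot_lip x) _; slin.
- by move=> b c; elim/qprojP=> x; rewrite !quot_lact (pe_lactA hE).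
- by elim/qprojP=> x a c; rewrite !quot_ract (pe_ractA hE).
- by move=> b; elim/qprojP=> x a; rewrite !(quot_lact, quot_ract) (pe_lractA hE).
- elim/qprojP=> x; apply: span_map (pe_lact_full hE x) => _ [b [y ->]].
  by apply: span_sub; exists b, (qproj S y); rewrite quot_lact.
- elim/qprojP=> x; apply: span_map (pe_ract_full hE x) => _ [y [a ->]].
  by apply: span_sub; exists (qproj S y), a; rewrite quot_ract.
- elim/qprojP=> x; elim/qprojP=> y a.
  by rewrite quot_ract !quot_rip (pe_rip_ract hE).
- by elim/qprojP=> x; elim/qprojP=> y; rewrite !quot_rip; exact: pe_rip_sym hE _ _.
- move=> a; apply: sub_span (pe_rip_full hE a) => _ [x [y ->]].
  by apply: span_sub; exists (qproj S x), (qproj S y); rewrite quot_rip.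
- move=> b; elim/qprojP=> x; elim/qprojP=> y.
  by rewrite quot_lact !quot_lip (pe_lip_lact hE).
- by elim/qprojP=> x; elim/qprojP=> y; rewrite !quot_lip; exact: pe_lip_sym hE _ _.
- move=> b; apply: sub_span (pe_lip_full hE b) => _ [x [y ->]].
  by apply: span_sub; exists (qproj S x), (qproj S y); rewrite quot_lip.
- elim/qprojP=> w; elim/qprojP=> x; elim/qprojP=> y; elim/qprojP=> z.
  by rewrite quot_lip quot_rip quot_lact quot_ract !quot_rip (pe_rip_lip_rip hE).
- elim/qprojP=> x; elim/qprojP=> y; elim/qprojP=> z; elim/qprojP=> w.
  by rewrite quot_lip quot_rip quot_lact quot_ract !quot_lip (pe_lip_lip_rip hE).
Qed.

End Quotient.

Local Notation D := (degeneracy E).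

Let DD : D `<=` D. Proof. by []. Qed.

Let Dl b x : span D x -> span D (b ·l x).
Proof. by move=> /span_degeneracy Dx; apply/span_sub/degeneracy_lact. Qed.

Let Dr x a : span D x -> span D (x ·r a).
Proof. by move=> /span_degeneracy Dx; apply/span_sub/degeneracy_ract. Qed.

Definition dquot_lact := quot_lact Dl.
Definition dquot_ract := quot_ract Dr.
Definition dquot_rip := quot_rip DD.

Lemma dquot_pre_equivalence : pre_equivalence (bimod_quot D).
Proof. exact: quot_pre_equivalence DD Dl Dr. Qed.

End PreEquivalenceTheory.

Section DegeneracyQuotient.
Variables (R : realDomainType) (B A : star_alg R) (E : bimod B A).
Context {sB : is_star_alg B} {sA : is_star_alg A} {hE : pre_equivalence E}.
Hypotheses (nB : nondegenerate_alg B) (nA : nondegenerate_alg A).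

Lemma dquot_equivalence : is_equivalence_bimodule (bimod_quot (degeneracy E)).
Proof.
have hQ := dquot_pre_equivalence nB nA.
apply: is_equivalence_of_nondegenerate => // u.
elim/qprojP: u => x Dx; rewrite -[RHS](slin0 (f := qproj (degeneracy E))).
apply/qproj_eqP; rewrite subr0; apply: span_sub => y.
by have := Dx (qproj _ y); rewrite dquot_rip.
Qed.

End DegeneracyQuotient.

(** * Comparison of equivalence bimodules on generators *)

Section GramMatrix.
Variables (R : realDomainType) (B A : star_alg R).
Context {sB : is_star_alg B} {sA : is_star_alg A}.
Hypothesis nB : nondegenerate_alg B.
Variable I : Type.

Lemma span_ind (U : lmodType (Cx R)) (S : set U) (Q : U -> Prop) :
  Q 0 -> (forall u v, Q u -> Q v -> Q (u + v)) ->
  (forall c u, Q u -> Q (c *: u)) -> (forall u, S u -> Q u) ->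
  forall u, span S u -> Q u.
Proof.
move=> Q0 QD QZ SQ _ [s sS ->]; rewrite big_seq.
by elim/big_ind: _ => // p /sS /SQ; apply: QZ.
Qed.

Lemma rip_inj (E : bimod B A) (I' : Type) (p : I' -> E) (x y : E) :
  is_equivalence_bimodule E ->
  (forall z, span [set z | exists i, z = p i] z) ->
  (forall i, ⟨p i, x⟩r = ⟨p i, y⟩r) -> x = y.
Proof.
move=> hE pE xy; apply/eqP; rewrite -subr_eq0; apply/eqP/(rip_nondeg hE) => z.
rewrite (rip_sym hE).
suff -> : ⟨z, x - y⟩r = 0 by rewrite (slin0 (f := @sa_star R _)).
apply: (span_map0 (f := fun z => ⟨z, x - y⟩r) (bislinl _ _) _ (pE z)).
by move=> _ [i ->]; rewrite (slinB (f := rip (p i))) xy subrr.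
Qed.

(** Each image is characterised by its pairings with the family [q], so mere existence is shown by
    induction on the span and the map is chosen afterwards. Independence of the chosen linear
    combination never has to be checked. *)
Lemma gram_ex (P Q : bimod B A) (p : I -> P) (q : I -> Q) :
  is_equivalence_bimodule P -> is_equivalence_bimodule Q ->
  (forall x, span [set x | exists i, x = p i] x) ->
  (forall i j, ⟨p i, p j⟩r = ⟨q i, q j⟩r) ->
  exists f : P -> Q, forall x i, ⟨q i, f x⟩r = ⟨p i, x⟩r.
Proof.
move=> hP hQ pP pq.
suff fE x : exists u, forall i, ⟨q i, u⟩r = ⟨p i, x⟩r.
  by exists (fun x => sval (cid (fE x))) => x; case: cid.
elim/span_ind: x / (pP x) => [|x y [u ux] [v vy]|c x [u ux]|_ [j ->]].
- by exists 0 => i; rewrite (slin0 (f := rip (q i))) (slin0 (f := rip (p i))).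
- by exists (u + v) => i; rewrite (slinD (f := rip _)) ux vy -(slinD (f := rip _)).
- by exists (c *: u) => i; rewrite (slinZ (f := rip _)) ux -(slinZ (f := rip _)).
- by exists (q j) => i.
Qed.

(* A bimodule is determined by the inner products of a generating family and
   by the left action on it; the left inner product is then forced by
   [lip_rip] and the nondegeneracy of [B] *)
Lemma gram_iso (P Q : bimod B A) (p : I -> P) (q : I -> Q) :
  is_equivalence_bimodule P -> is_equivalence_bimodule Q ->
  (forall x, span [set x | exists i, x = p i] x) ->
  (forall x, span [set x | exists i, x = q i] x) ->
  (forall i j, ⟨p i, p j⟩r = ⟨q i, q j⟩r) ->
  (forall b i j, ⟨p i, b ·l p j⟩r = ⟨q i, b ·l q j⟩r) -> bimod_iso P Q.
Proof.
move=> hP hQ pP qQ pq bpq.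
have [f fE] := gram_ex hP hQ pP pq.
have [g gE] : exists g : Q -> P, forall y i, ⟨p i, g y⟩r = ⟨q i, y⟩r.
  by apply: gram_ex.
have gK : cancel g f by move=> y; apply: (rip_inj hQ qQ) => i; rewrite fE gE.
have fp i : f (p i) = q i.
  by apply: (rip_inj hQ qQ) => j; rewrite fE pq.
have fL : slin false f.
  move=> c x y; apply: (rip_inj hQ qQ) => i.
  by rewrite fE !(slinD (f := rip _)) !(slinZ (f := rip _)) !fE.
(* The Gram matrix controls the right module structure only; the hypothesis [bpq] is what gives left
   linearity. *)
have fl b x : f (b ·l x) = b ·l f x.
  apply/eqP; rewrite -subr_eq0; apply/eqP.
  apply: (span_map0 (s := false) (f := fun x => f (b ·l x) - b ·l f x) _ _ (pP x)).
    by apply: slin_sub; slin.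
  move=> _ [j ->]; apply/eqP; rewrite subr_eq0; apply/eqP.
  by apply: (rip_inj hQ qQ) => i; rewrite fE fp bpq.
have fr x a : f (x ·r a) = f x ·r a.
  by apply: (rip_inj hQ qQ) => i; rewrite (rip_ract hQ) !fE (rip_ract hP).
have frip x y : ⟨f x, f y⟩r = ⟨x, y⟩r.
  apply/eqP; rewrite -subr_eq0; apply/eqP.
  apply: (span_map0 (s := true) (f := fun x => ⟨f x, f y⟩r - ⟨x, y⟩r) _ _ (pP x)).
    by apply: slin_sub; slin.
  by move=> _ [j ->]; rewrite fp fE subrr.
exists f; split.
  by exists g => // x; apply: (rip_inj hP pP) => i; rewrite gE fE.
split=> // x y.
apply/eqP; rewrite -subr_eq0; apply/eqP; apply: (lip_mul0 nB) => z w.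
rewrite -(lip_lact hQ) (slinB (f := fun b => b ·l z) (fL := bislinl _ _)).
rewrite (lip_rip hQ) -{1}[z]gK frip -{2}[z]gK -fl (lip_rip hP) fr subrr.
exact: (slin0 (f := fun x => ⟨x, w⟩l) (fL := bislinl _ _)).
Qed.

End GramMatrix.

(** * Composition of equivalence bimodules *)

Section TensorProduct.
Variables (R : realDomainType) (C B A : star_alg R).
Variables (F : bimod C B) (E : bimod B A).
Context {sC : is_star_alg C} {sB : is_star_alg B} {sA : is_star_alg A}.
Context {hF : is_equivalence_bimodule F} {hE : is_equivalence_bimodule E}.
Hypotheses (nC : nondegenerate_alg C) (nA : nondegenerate_alg A).
Local Notation T := (bimod_tens F E).
Implicit Types (x : E) (y : F) (t u v w : tensor F E).

Local Notation tl := (@lact R C A T).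
Local Notation tr := (@ract R C A T).
Local Notation tip := (@rip R C A T).
Local Notation tlip := (@lip R C A T).

#[export] Instance tens_lact_bislin : bislin false false tl.
Proof. by cbn [lact bimod_tens]; bislin. Qed.

#[export] Instance tens_ract_bislin : bislin false false tr.
Proof. by cbn [ract bimod_tens]; bislin. Qed.

#[export] Instance tens_rip_bislin : bislin true false tip.
Proof. by cbn [rip bimod_tens]; bislin. Qed.

#[export] Instance tens_lip_bislin : bislin false true tlip.
Proof. by cbn [lip bimod_tens]; bislin. Qed.

Lemma tens_lactE c y x : tl c (y ⊗ x) = (c ·l y) ⊗ x.
Proof. by apply: (tlift_pure (s := false)); bislin. Qed.

Lemma tens_ractE y x a : tr (y ⊗ x) a = y ⊗ (x ·r a).
Proof. by apply: (tlift_pure (s := false)); bislin. Qed.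

Lemma tens_ripE y x y' x' : tip (y ⊗ x) (y' ⊗ x') = ⟨x, ⟨y, y'⟩r ·l x'⟩r.
Proof.
rewrite [LHS](tlift_pure (s := true)); last by bislin.
by apply: (tlift_pure (s := false)); bislin.
Qed.

Lemma tens_lipE y x y' x' : tlip (y ⊗ x) (y' ⊗ x') = ⟨y ·r ⟨x, x'⟩l, y'⟩l.
Proof.
rewrite [LHS](tlift_pure (s := false)); last by bislin.
by apply: (tlift_pure (s := true)); bislin.
Qed.

(** Inner products do not distinguish the two sides of a balancing relation. Hence the compatibility
    of the two inner products already holds weakly before any quotient is taken. *)
Lemma tens_rip_balanced w y b x : tip w ((y ·r b) ⊗ x) = tip w (y ⊗ (b ·l x)).
Proof.
tensor_ext_as true w => y' x'; rewrite !tens_ripE.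
by rewrite (rip_ract hF) (lactA (eb_bimodule hE)).
Qed.

Lemma tens_lip_balanced w y b x : tlip ((y ·r b) ⊗ x) w = tlip (y ⊗ (b ·l x)) w.
Proof.
tensor_ext_as true w => y' x'; rewrite !tens_lipE.
by rewrite (lip_lact hE) (ractA (eb_bimodule hF)).
Qed.

Lemma tens_pre_equivalence : pre_equivalence T.
Proof.
have [_ _ lF rF lrF _ _] := eb_bimodule hF.
have [_ _ lE rE lrE _ _] := eb_bimodule hE.
split; try by typeclasses eauto.
- move=> b c t; tensor_ext t => y x.
  by rewrite !tens_lactE lF.
- move=> t a c; tensor_ext t => y x.
  by rewrite !tens_ractE rE.
- move=> b t a; tensor_ext t => y x.
  by rewrite !(tens_ractE, tens_lactE).
- elim/tensor_ind => [|t u|y x]; [exact: span0|exact: spanD|].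
  apply: (span_map (f := fun y => y ⊗ x) (bislinl _ _) _ (lact_full hF y)).
  by move=> _ [c [z ->]]; apply: span_sub; exists c, (z ⊗ x); rewrite -tens_lactE.
- elim/tensor_ind => [|t u|y x]; [exact: span0|exact: spanD|].
  apply: (span_map (f := tens y) _ _ (ract_full hE x)).
  by move=> _ [z [a ->]]; apply: span_sub; exists (y ⊗ z), a; rewrite -tens_ractE.
- move=> t u a; tensor_ext_as true t => y x; tensor_ext u => y' x'.
  by rewrite tens_ractE !tens_ripE -lrE (rip_ract hE).
- move=> t u; tensor_ext_as true t => y x; tensor_ext u => y' x'.
  by rewrite !tens_ripE -(rip_sym hE) (pe_rip_lact nA) -(rip_sym hF).
(* Expanding the second argument as [b ·l x''], and then [b] in inner products of [F], produces
   exactly the values in [tens_ripE]. *)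
- move=> a; apply: sub_span (rip_full hE a) => _ [x [x' ->]].
  apply: (span_map (f := rip x) _ _ (lact_full hE x')) => _ [b [x'' ->]].
  apply: (span_map (f := fun b => ⟨x, b ·l x''⟩r) _ _ (rip_full hF b)).
    by slin.
  move=> _ [y [y' ->]]; apply: span_sub; exists (y ⊗ x), (y' ⊗ x'').
  by rewrite -tens_ripE.
- move=> c t u; tensor_ext t => y x; tensor_ext_as true u => y' x'.
  by rewrite tens_lactE !tens_lipE lrF (lip_lact hF).
- move=> t u; tensor_ext t => y x; tensor_ext_as true u => y' x'.
  by rewrite !tens_lipE -(lip_sym hF) (pe_lip_ract nC) -(lip_sym hE).
- move=> c; apply: sub_span (lip_full hF c) => _ [y [y' ->]].
  apply: (span_map (f := fun y => ⟨y, y'⟩l) _ _ (ract_full hF y)).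
    by slin.
  move=> _ [y'' [b ->]].
  apply: (span_map (f := fun b => ⟨y'' ·r b, y'⟩l) _ _ (lip_full hE b)).
    by slin.
  move=> _ [x [x' ->]]; apply: span_sub; exists (y'' ⊗ x), (y' ⊗ x').
  by rewrite -tens_lipE.
- move=> w t u v; tensor_ext t => y x; tensor_ext_as true u => y' x'.
  tensor_ext v => y'' x''.
  rewrite tens_lactE tens_ractE tens_lipE tens_ripE (lip_rip hF).
  by rewrite !tens_rip_balanced (lip_rip hE).
- move=> t u v w; tensor_ext t => y x; tensor_ext_as true u => y' x'.
  tensor_ext v => y'' x''.
  rewrite tens_lactE tens_ractE tens_lipE tens_ripE (lip_rip hF).
  by rewrite !tens_lip_balanced (lip_rip hE).
Qed.

Lemma balancing_degeneracy : balancing F E `<=` degeneracy T.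
Proof.
move=> _ [y [b [x ->]]] w; rewrite (pe_rip_sym tens_pre_equivalence).
by rewrite (slinB (f := tip w)) tens_rip_balanced subrr (slin0 (f := @sa_star _ _)).
Qed.

Lemma balancing_lact c t : span (balancing F E) t -> span (balancing F E) (tl c t).
Proof.
apply: span_map => _ [y [b [x ->]]]; apply: span_sub.
exists (c ·l y), b, x; rewrite (slinB (f := tl c)) !tens_lactE.
by rewrite (lractA (eb_bimodule hF)).
Qed.

Lemma balancing_ract t a : span (balancing F E) t -> span (balancing F E) (tr t a).
Proof.
apply: (span_map (f := fun t => tr t a) (bislinl _ _)) => _ [y [b [x ->]]].
apply: span_sub; exists y, b, (x ·r a).
rewrite (slinB (f := fun t => tr t a) (fL := bislinl _ _)) !tens_ractE.
by rewrite (lractA (eb_bimodule hE)).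
Qed.

Definition btens_lact := quot_lact (hE := tens_pre_equivalence) balancing_lact.
Definition btens_rip := quot_rip (hE := tens_pre_equivalence) balancing_degeneracy.

Lemma btens_pre_equivalence : pre_equivalence (bimod_btens F E).
Proof.
exact: (quot_pre_equivalence (hE := tens_pre_equivalence) nC
  balancing_degeneracy balancing_lact balancing_ract).
Qed.

Lemma comp_equivalence : is_equivalence_bimodule (bimod_comp F E).
Proof. by have hT := btens_pre_equivalence; apply: dquot_equivalence. Qed.

Definition comp_tens y x : bimod_comp F E :=
  qproj (degeneracy (bimod_btens F E)) (qproj (balancing F E) (y ⊗ x)).

#[export] Instance comp_tens_bislin : bislin false false comp_tens.
Proof. by rewrite /comp_tens; bislin. Qed.

Lemma comp_balanced y b x : comp_tens (y ·r b) x = comp_tens y (b ·l x).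
Proof.
congr (qproj _ _); apply/qproj_eqP/span_sub.
by exists y, b, x.
Qed.

Let hT := btens_pre_equivalence.

Lemma comp_ripE y x y' x' :
  ⟨comp_tens y x, comp_tens y' x'⟩r = ⟨x, ⟨y, y'⟩r ·l x'⟩r.
Proof. by rewrite (dquot_rip (hE := hT)) btens_rip tens_ripE. Qed.

Lemma comp_lactE (c : C) y x : c ·l comp_tens y x = comp_tens (c ·l y) x.
Proof. by rewrite (dquot_lact (hE := hT) nA) btens_lact tens_lactE. Qed.

Lemma comp_span (u : bimod_comp F E) :
  span [set v | exists y x, v = comp_tens y x] u.
Proof.
elim/qprojP: u => v; elim/qprojP: v => t; rewrite [t]tensor_sum.
rewrite !(slin_sum (f := qproj _)); apply: span_big => p.
by apply: span_sub; exists p.1, p.2.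
Qed.

End TensorProduct.

(** * Covariance *)

#[global] Existing Instance hsa_module.

Section Covariance.
Variables (R : realDomainType) (H : hopf_star_alg R) (B A : h_star_alg H).
Implicit Types (g h k : H).
Local Notation S := (@antipode R H).

(* Unlike [is_covariant], this does not mention the antipode, and so passes to
   tensor products without the formula for the coproduct of [S g] *)
Record pre_covariant (E : h_bimod B A) : Prop := PreCovariant {
  pc_module : is_h_module (@hb_act R H B A E);
  pc_lact : equivariant (@hsa_act R H B) (@hb_act R H B A E)
    (@hb_act R H B A E) (@lact R B A E);
  pc_ract : equivariant (@hb_act R H B A E) (@hsa_act R H A)
    (@hb_act R H B A E) (@ract R B A E);
  pc_rip : forall (g : H) (x y : E), ⟨x, g ▶ y⟩r =
    \tsum_(g1, g2 <- Delta g) g2 ▷ ⟨hstar g1 ▶ x, y⟩r }.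

Existing Class pre_covariant.
#[global] Existing Instance pc_module.

Variable E : h_bimod B A.
Context {sB : is_star_alg B} {sA : is_star_alg A}.
Context {aB : is_star_action B} {aA : is_star_action A}.
Context {hE : is_equivalence_bimodule E}.

Lemma rip_ext (x y : E) : (forall z, ⟨z, x⟩r = ⟨z, y⟩r) -> x = y.
Proof.
move=> xy; apply/eqP; rewrite -subr_eq0; apply/eqP/(rip_nondeg hE) => z.
by rewrite (rip_sym hE) (slinB (f := rip z)) xy subrr (slin0 (f := @sa_star R _)).
Qed.

Lemma lip_ext (x y : E) : (forall z, ⟨x, z⟩l = ⟨y, z⟩l) -> x = y.
Proof.
move=> xy; apply/eqP; rewrite -subr_eq0; apply/eqP/(lip_nondeg hE) => z.
by rewrite (slinB (f := fun x => ⟨x, z⟩l)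
  (fL := bislinl (pe_lip _) _)) xy subrr.
Qed.

(** Equivariance of both module actions follows from that of the inner products by testing against
    an arbitrary [z]. For this, covariance is first solved for an action on a single argument. *)
Lemma pre_covariant_of : is_covariant E -> pre_covariant E.
Proof.
case=> mE ripE lipE.
have pcr g (x y : E) : ⟨x, g ▶ y⟩r =
    \tsum_(g1, g2 <- Delta g) g2 ▷ ⟨hstar g1 ▶ x, y⟩r.
  under eq_tlift => g1 d.
    rewrite ripE.
    under eq_tlift => g2 g3 do rewrite -(hm_mul mE) -hstarM.
  over.
  rewrite (tsum_Sr (s := false) (F := fun u w => ⟨hstar u ▶ x, w ▶ y⟩r)).
    by rewrite hstar1 (hm_one mE).
  by bislin.
(* The double antipode is the cancelling factor: [hb_lip] contributes [hstar (S g2)], and together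
   with [hstar (S (S g3))] it forms [hstar (S (g2 * S g3))]. *)
have pcl g (x y : E) : ⟨g ▶ x, y⟩l =
    \tsum_(g1, g2 <- Delta g) g1 ▷ ⟨x, hstar (S (S g2)) ▶ y⟩l.
  under [RHS]eq_tlift => d g3.
    rewrite lipE.
    under eq_tlift => g1 g2 do
      rewrite -(hm_mul mE) -hstarM -antipode_mul.
  over.
  rewrite (tsum_coassoc (s := false)
    (F := fun g1 g2 g3 => ⟨g1 ▶ x, hstar (S (g2 * S g3)) ▶ y⟩l)).
    rewrite (tsum_tailSr (s := false)
      (F := fun u w => ⟨u ▶ x, hstar (S w) ▶ y⟩l)).
      by rewrite antipode1 hstar1 (hm_one mE).
    by bislin.
  by trislin.
split=> // [g b x|g x a].
  apply: lip_ext => z; rewrite pcl.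
  under eq_tlift => d g3 do rewrite (lip_lact hE) (hsa_mul aB).
  rewrite (tsum_coassoc (s := false) (F := fun g1 g2 g3 =>
    (g1 ▷ b) ·m (g2 ▷ ⟨x, hstar (S (S g3)) ▶ z⟩l))); last by trislin.
  rewrite (slin_tlift (f := fun x => ⟨x, z⟩l) (fL := bislinl (pe_lip _) _)).
  apply: eq_tlift => g1 d.
  by rewrite (lip_lact hE) pcl (slin_tlift (f := sa_mul _)).
apply: rip_ext => z; rewrite pcr.
under eq_tlift => g1 d do rewrite (rip_ract hE) (hsa_mul aA).
rewrite -(tsum_coassoc (s := false) (F := fun g1 g2 g3 =>
    (g2 ▷ ⟨hstar g1 ▶ z, x⟩r) ·m (g3 ▷ a))); last by trislin.
rewrite (slin_tlift (f := rip z)); apply: eq_tlift => d g3.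
rewrite (rip_ract hE) pcr.
by rewrite (slin_tlift (f := fun c => c ·m _)
  (fL := bislinl (@sa_mul_bislin _ _ _) _)).
Qed.

(** Covariance of the left inner product is recovered by letting both sides act on a vector [z],
    where [lip_rip] replaces left inner products by right ones. *)
Lemma is_covariant_of : nondegenerate_alg B -> pre_covariant E -> is_covariant E.
Proof.
move=> nB [mE lE rE pcr].
have ripE g (x y : E) : g ▷ ⟨x, y⟩r =
    \tsum_(g1, g2 <- Delta g) ⟨hstar (S g1) ▶ x, g2 ▶ y⟩r.
  under eq_tlift => g1 d.
    rewrite pcr.
    under eq_tlift => g2 g3 do rewrite -(hm_mul mE) -hstarM.
  over.
  rewrite (tsum_Sl (s := false) (F := fun u w => w ▷ ⟨hstar u ▶ x, y⟩r)).
    by rewrite hstar1 (hm_one mE).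
  by bislin.
split=> // g x y.
apply/eqP; rewrite -subr_eq0; apply/eqP/(lip_mul0 nB) => z w.
rewrite -(lip_lact hE).
suff -> : (g ▷ ⟨x, y⟩l - \tsum_(g1, g2 <- Delta g)
    ⟨g1 ▶ x, hstar (S g2) ▶ y⟩l) ·l z = 0.
  exact: (slin0 (f := fun x => ⟨x, w⟩l) (fL := bislinl (pe_lip _) _)).
rewrite (slinB (f := fun b => b ·l z) (fL := bislinl (pe_lact _) _)).
apply/eqP; rewrite subr_eq0; apply/eqP.
rewrite (slin_tlift (f := fun b => b ·l z) (fL := bislinl (pe_lact _) _)).
(* A factor [g2 * S g3] is inserted in front of [z], so that equivariance of the left action can
   pull g1 and g2 out as one action on ⟨x, y⟩ times [S g3 ▶ z]. *)
transitivity (\tsum_(g1, d <- Delta g) \tsum_(g2, g3 <- Delta d)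
    (g1 ▷ ⟨x, y⟩l) ·l ((g2 * S g3) ▶ z)).
  rewrite (tsum_tailSr (s := false)
    (F := fun u w => (u ▷ ⟨x, y⟩l) ·l (w ▶ z))) ?(hm_one mE) //.
  by bislin.
rewrite -(tsum_coassoc (s := false) (F := fun g1 g2 g3 =>
    (g1 ▷ ⟨x, y⟩l) ·l ((g2 * S g3) ▶ z))); last by trislin.
transitivity (\tsum_(d, g3 <- Delta g) \tsum_(g1, g2 <- Delta d)
    (g1 ▶ x) ·r (g2 ▷ ⟨y, S g3 ▶ z⟩r)).
  apply: eq_tlift => d g3; rewrite -rE -(lip_rip hE) lE.
  by apply: eq_tlift => g1 g2; rewrite (hm_mul mE).
rewrite (tsum_coassoc (s := false) (F := fun g1 g2 g3 =>
    (g1 ▶ x) ·r (g2 ▷ ⟨y, S g3 ▶ z⟩r))); last by trislin.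
apply: eq_tlift => g1 d; rewrite (lip_rip hE).
rewrite -(slin_tlift (f := ract (g1 ▶ x))); congr (_ ·r _).
under eq_tlift => e g4.
  rewrite ripE; under eq_tlift => g2 g3 do rewrite -(hm_mul mE).
over.
rewrite (tsum_coassoc (s := false) (F := fun g2 g3 g4 =>
    ⟨hstar (S g2) ▶ y, (g3 * S g4) ▶ z⟩r)); last by trislin.
rewrite (tsum_tailSr (s := false)
    (F := fun u w => ⟨hstar (S u) ▶ y, w ▶ z⟩r)) ?(hm_one mE) //.
by bislin.
Qed.

End Covariance.

Section CovariantQuotient.
Variables (R : realDomainType) (H : hopf_star_alg R) (B A : h_star_alg H).
Variable E : h_bimod B A.
Context {sB : is_star_alg B} {sA : is_star_alg A}.
Context {aA : is_star_action A}.
Context {hE : pre_equivalence E}.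
Context {cE : pre_covariant E}.

Lemma degeneracy_act g (x : E) : degeneracy E x -> degeneracy E (g ▶ x).
Proof.
move=> Dx y; rewrite (pe_rip_sym hE) (pc_rip cE) tlift_eq0.
  exact: (slin0 (f := @sa_star R _)).
move=> g1 g2; rewrite (pe_rip_sym hE) Dx (slin0 (f := @sa_star R _)).
exact: (slin0 (f := hsa_act g2)).
Qed.

Variable S : set E.
Hypothesis SD : S `<=` degeneracy E.
Hypothesis Sl : forall b x, span S x -> span S (b ·l x).
Hypothesis Sr : forall x a, span S x -> span S (x ·r a).
Hypothesis Sa : forall g x, span S x -> span S (g ▶ x).
Local Notation Q := (h_bimod_quot S).

Lemma quot_act g x : g ▶ (qproj S x : Q) = qproj S (g ▶ x).
Proof.
apply/qproj_eqP; rewrite -(slinB (f := @hb_act R H B A E g)).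
exact/Sa/qreprE.
Qed.

Lemma quot_pre_covariant : pre_covariant Q.
Proof.
split.
- split=> [|g h|]; last 2 first.
  + by elim/qprojP=> x; rewrite !quot_act (hm_mul (pc_module cE)).
  + by elim/qprojP=> x; rewrite quot_act (hm_one (pc_module cE)).
  apply: bilinear_of_bislin; split=> [u|g].
    elim/qprojP: u => x; apply: slin_eq (fun g => quot_act g x) _; slin.
  by apply: slin_quot; apply: slin_eq (quot_act g) _; slin.
- move=> g b; elim/qprojP=> x.
  rewrite (quot_lact Sl) quot_act (pc_lact cE) (slin_tlift (f := qproj S)).
  by apply: eq_tlift => g1 g2; rewrite quot_act (quot_lact Sl).
- move=> g; elim/qprojP=> x a.
  rewrite (quot_ract Sr) quot_act (pc_ract cE) (slin_tlift (f := qproj S)).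
  by apply: eq_tlift => g1 g2; rewrite quot_act (quot_ract Sr).
- move=> g; elim/qprojP=> x; elim/qprojP=> y.
  rewrite quot_act (quot_rip SD) (pc_rip cE).
  by apply: eq_tlift => g1 g2; rewrite quot_act (quot_rip SD).
Qed.

End CovariantQuotient.

Section CovariantTensorProduct.
Variables (R : realDomainType) (H : hopf_star_alg R) (C B A : h_star_alg H).
Variables (F : h_bimod C B) (E : h_bimod B A).
Context {sC : is_star_alg C} {sB : is_star_alg B} {sA : is_star_alg A}.
Context {aC : is_star_action C} {aB : is_star_action B} {aA : is_star_action A}.
Context {hF : is_equivalence_bimodule F} {hE : is_equivalence_bimodule E}.
Hypotheses (nC : nondegenerate_alg C) (nA : nondegenerate_alg A).
Context {cF : pre_covariant F} {cE : pre_covariant E}.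
Local Notation T := (h_bimod_tens F E).
Local Notation act := (@hb_act R H C A T).

#[export] Instance tens_act_bislin : bislin false false act.
Proof. by cbn [hb_act h_bimod_tens]; bislin. Qed.

Lemma tens_actE g (y : F) (x : E) :
  act g (y ⊗ x) = \tsum_(g1, g2 <- Delta g) (g1 ▶ y) ⊗ (g2 ▶ x).
Proof. by apply: (tlift_pure (s := false)); bislin. Qed.

Lemma tens_pre_covariant : pre_covariant T.
Proof.
split.
- split=> [|g h t|t]; first by exact: bilinear_of_bislin.
    tensor_ext t => y x; rewrite !tens_actE (tsum_DeltaM (s := false)).
      rewrite (slin_tlift (f := act g)) exchange_tlift.
      apply: eq_tlift => h1 h2; rewrite tens_actE.
      by apply: eq_tlift => g1 g2; rewrite (hm_mul (pc_module cF))
        (hm_mul (pc_module cE)).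
    by bislin.
  tensor_ext t => y x; rewrite tens_actE (tsum_Delta1 (s := false)).
    by rewrite (hm_one (pc_module cF)) (hm_one (pc_module cE)).
  by bislin.
- move=> g c t; tensor_ext t => y x.
  rewrite tens_lactE tens_actE.
  under [LHS]eq_tlift => d g3.
    rewrite (pc_lact cF).
    rewrite (slin_tlift (f := fun y => y ⊗ (g3 ▶ x))
      (fL := bislinl (tens_bislin _ _) _)).
  over.
  rewrite (tsum_coassoc (s := false)
    (F := fun g1 g2 g3 => (g1 ▷ c) ·l (g2 ▶ y) ⊗ (g3 ▶ x))); last by trislin.
  apply: eq_tlift => g1 d; rewrite tens_actE (slin_tlift (f := lact _)).
  by apply: eq_tlift => g2 g3; rewrite tens_lactE.
- move=> g t a; tensor_ext t => y x.
  rewrite tens_ractE tens_actE.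
  under [LHS]eq_tlift => g1 d.
    rewrite (pc_ract cE) (slin_tlift (f := tens (g1 ▶ y))).
  over.
  rewrite -(tsum_coassoc (s := false)
    (F := fun g1 g2 g3 => (g1 ▶ y) ⊗ ((g2 ▶ x) ·r (g3 ▷ a)))); last by trislin.
  apply: eq_tlift => d g3; rewrite tens_actE.
  rewrite (slin_tlift (f := fun t => t ·r _)
    (fL := bislinl (op := @ract R C A T) _ _)).
  by apply: eq_tlift => g1 g2; rewrite tens_ractE.
(* The legs pass through the inner product of [F], the left action of [B] and the inner product of
   [E] in turn. The two starred legs recombine because [hstar] respects the coproduct. *)
- move=> g t u; tensor_ext_as true t => y x; tensor_ext u => y' x'.
  rewrite tens_actE (slin_tlift (f := rip _)).
  under [LHS]eq_tlift => d g3.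
    rewrite tens_ripE (pc_rip cF).
    rewrite (slin_tlift (f := fun b => ⟨x, b ·l (g3 ▶ x')⟩r)
      (fL := slin_comp (s := false) (r := false) (bislinr (pe_rip _) _)
        (bislinl (pe_lact _) _))).
  over.
  rewrite (tsum_coassoc (s := false) (F := fun g1 g2 g3 =>
    ⟨x, (g2 ▷ ⟨hstar g1 ▶ y, y'⟩r) ·l (g3 ▶ x')⟩r)); last by trislin.
  under [LHS]eq_tlift => g1 d.
    rewrite -(slin_tlift (f := rip x)) -(pc_lact cE) (pc_rip cE).
  over.
  rewrite -(tsum_coassoc (s := false) (F := fun g1 g2 g3 =>
    g3 ▷ ⟨hstar g2 ▶ x, ⟨hstar g1 ▶ y, y'⟩r ·l x'⟩r)); last by trislin.
  apply: eq_tlift => d g3; rewrite -(slin_tlift (f := hsa_act g3)); congr (_ ▷ _).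
  rewrite tens_actE (tsum_Delta_star (s := false)); last by bislin.
  rewrite (slin_tlift (f := fun t => ⟨t, _⟩r)
    (fL := bislinl (op := @rip R C A T) _ _)).
  by apply: eq_tlift => g1 g2; rewrite tens_ripE.
Qed.

Lemma balancing_act g (t : T) :
  span (balancing F E) t -> span (balancing F E) (act g t).
Proof.
apply: span_map => _ [y [b [x ->]]]; rewrite (slinB (f := act g)) !tens_actE.
under [X in X - _]eq_tlift => d g3.
  rewrite (pc_ract cF).
  rewrite (slin_tlift (f := fun y => y ⊗ (g3 ▶ x))
    (fL := bislinl (tens_bislin _ _) _)).
over.
under [X in _ - X]eq_tlift => g1 d.
  rewrite (pc_lact cE) (slin_tlift (f := tens (g1 ▶ y))).
over.
rewrite (tsum_coassoc (s := false)
  (F := fun g1 g2 g3 => ((g1 ▶ y) ·r (g2 ▷ b)) ⊗ (g3 ▶ x))); last by trislin.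
rewrite -tliftB; apply: span_tlift => g1 d.
rewrite -tliftB; apply: span_tlift => g2 g3.
by apply: span_sub; exists (g1 ▶ y), (g2 ▷ b), (g3 ▶ x).
Qed.

Lemma btens_pre_covariant : pre_covariant (h_bimod_btens F E).
Proof.
have cT := tens_pre_covariant; have hT := tens_pre_equivalence nC nA.
apply: quot_pre_covariant.
- exact: balancing_degeneracy.
- by move=> c t; apply: balancing_lact.
- by move=> t a; apply: balancing_ract.
- exact: balancing_act.
Qed.

Local Notation D := (degeneracy (bimod_btens F E)).

Let span_D x : span D x -> D x.
Proof. by have hT := btens_pre_equivalence nC nA; apply: span_degeneracy. Qed.

Let act_D g (x : h_bimod_btens F E) : span D x -> span D (g ▶ x).
Proof.
have cT := btens_pre_covariant; have hT := btens_pre_equivalence nC nA.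
by move=> /span_D Dx; apply: span_sub;
  apply: (degeneracy_act (E := h_bimod_btens F E)).
Qed.

Lemma h_comp_pre_covariant : pre_covariant (h_bimod_comp F E).
Proof.
have cT := btens_pre_covariant; have hT := btens_pre_equivalence nC nA.
apply: quot_pre_covariant => [//|c x /span_D Dx|x a /span_D Dx|]; last exact: act_D.
  by apply/span_sub/degeneracy_lact.
by apply/span_sub/degeneracy_ract.
Qed.

Lemma comp_actE g y x : g ▶ (comp_tens y x : h_bimod_comp F E) =
  \tsum_(g1, g2 <- Delta g) comp_tens (g1 ▶ y) (g2 ▶ x).
Proof.
have cT := btens_pre_covariant; have hT := btens_pre_equivalence nC nA.
have cT0 := tens_pre_covariant; have hT0 := tens_pre_equivalence nC nA.
rewrite (quot_act (E := h_bimod_btens F E) act_D) (quot_act balancing_act).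
by rewrite tens_actE !(slin_tlift (f := qproj _)).
Qed.

Lemma h_comp_arr : is_equivalence_bimodule (h_bimod_comp F E) /\
  is_covariant (h_bimod_comp F E).
Proof.
have hFE : is_equivalence_bimodule (h_bimod_comp F E) by exact: comp_equivalence.
by split=> //; apply: is_covariant_of => //; exact: h_comp_pre_covariant.
Qed.

End CovariantTensorProduct.

(** * Crossed product algebras and bimodules *)

Section CrossedAlgebra.
Variables (R : realDomainType) (H : hopf_star_alg R) (A : h_star_alg H).
Context {sA : is_star_alg A} {aA : is_star_action A}.
Implicit Types (g h k : H) (a b : A) (t u : tensor A H).
Local Notation S := (@antipode R H).
Local Notation lamA := (lam (@hsa_act R H A)).
Local Notation xmul := (@sa_mul R (crossed A)).
Local Notation xstar := (@sa_star R (crossed A)).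

Lemma crossed_mulE : xmul = xmap (@hsa_act R H A) (@sa_mul R A).
Proof. by []. Qed.

#[export] Instance crossed_mul_bislin : bislin false false xmul.
Proof. by rewrite crossed_mulE; typeclasses eauto. Qed.

#[export] Instance crossed_star_slin : slin true xstar.
Proof. by cbn [sa_star crossed]; slin. Qed.

Lemma xstar_tens a g : xstar (a ⊗ g) = lamA (hstar g) (a^★ ⊗ 1).
Proof.
rewrite [LHS](tlift_pure (s := true)); last by bislin.
rewrite lam_tens (tsum_Delta_star (s := false)); last by bislin.
by apply: eq_tlift => g1 g2; rewrite mulr1.
Qed.

(** On the factor in [A] the legs compose to [hstar (S k1 * k2)], which the antipode axiom cancels;
    only the last leg survives, in [H]. *)
Lemma lam_cancel k a :
  \tsum_(k1, k2 <- Delta k) lamA (hstar k2) ((hstar (S k1) ▷ a) ⊗ 1) =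
  a ⊗ hstar k.
Proof.
under eq_tlift => k1 d.
  rewrite lam_tens (tsum_Delta_star (s := false)); last by bislin.
  under eq_tlift => k2 k3 do
    rewrite -(hm_mul (hsa_module aA)) -hstarM mulr1.
over.
rewrite (tsum_Sl (s := true) (F := fun u w : H => (hstar u ▷ a) ⊗ hstar w)).
  by rewrite hstar1 (hm_one (hsa_module aA)).
by bislin.
Qed.

(** Formally the adjoint of k a g is computed by reversing the three factors and starring each.
    Involutivity of the star and symmetry of the right inner product are both read off from this. *)
Lemma xstar_lam k a g :
  xstar (lamA k (a ⊗ g)) = lamA (hstar g) (a^★ ⊗ hstar k).
Proof.
rewrite lam_tens (slin_tlift (f := xstar)) -lam_cancel.
rewrite (slin_tlift (f := lamA _)); apply: eq_tlift => k1 k2.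
by rewrite xstar_tens hstarM lam_mul (hsa_star aA).
Qed.

Lemma lam_lmap_cancel (V W : lmodType (Cx R)) (actV : H -> V -> V)
    (actW : H -> W -> W) (m : A -> V -> W) {hV : is_h_module actV}
    {hW : is_h_module actW} {mB : bislin false false m}
    (mE : equivariant (@hsa_act R H A) actV actW m) k a (t : tensor V H) :
  \tsum_(k1, k2 <- Delta k)
     lam actW (hstar k2) (lmap m (hstar (S k1) ▷ a) t) =
  lmap m a (lam actV (hstar k) t).
Proof.
under eq_tlift => k1 d.
  rewrite (lam_lmap mE) (tsum_Delta_star (s := false)); last by bislin.
  under eq_tlift => k2 k3 do rewrite -(hm_mul (hsa_module aA)) -hstarM.
over.
rewrite (tsum_Sl (s := true)
  (F := fun u w : H => lmap m (hstar u ▷ a) (lam actV (hstar w) t))).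
  by rewrite hstar1 (hm_one (hsa_module aA)).
by bislin.
Qed.

Lemma crossed_star_alg : is_star_alg (crossed A).
Proof.
have mE : equivariant (@hsa_act R H A) (@hsa_act R H A) (@hsa_act R H A)
  (@sa_mul R A) by exact: hsa_mul aA.
split.
- exact: bilinear_of_bislin crossed_mul_bislin.
- move=> t u v; rewrite !crossed_mulE; apply/esym.
  by apply: xmapA => // a b c; rewrite (sa_assoc sA).
- exact: crossed_star_slin.
- move=> t; tensor_ext t => a g.
  rewrite xstar_tens xstar_lam (sa_starK sA) hstar1 lam1.
  by rewrite hstarK.
- move=> t u; tensor_ext_as true t => a g; tensor_ext_as true u => b h.
  rewrite !crossed_mulE xmap_tens (slin_tlift (f := xstar)).
  (* On the right, [hstar h] is pulled out by [lam_xmap]; the remaining identity is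
     [lam_lmap_cancel] for b^★ acting on the adjoint of a ⊗ g. *)
  rewrite [xstar (b ⊗ h)]xstar_tens.
  rewrite -(lam_xmap mE) xmap_tensl lam1 xstar_tens -(lam_lmap_cancel mE).
  rewrite (slin_tlift (f := lamA _)); apply: eq_tlift => g1 g2.
  rewrite xstar_tens hstarM lam_mul lmap_tens (sa_starM sA).
  by rewrite (hsa_star aA).
Qed.

Lemma crossed_idempotent : idempotent_alg A -> idempotent_alg (crossed A).
Proof.
move=> iA t; elim/tensor_ind: t => [|t u|c h]; [exact: span0|exact: spanD|].
apply: (span_map (f := fun c => c ⊗ h) _ _ (iA c)); first by slin.
move=> _ [a [b ->]]; apply: span_sub; exists (a ⊗ 1), (b ⊗ h).
by rewrite crossed_mulE xmap_tens1.
Qed.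

End CrossedAlgebra.

Existing Class is_covariant.
#[global] Existing Instance hb_module.

Section CrossedBimodule.
Variables (R : realDomainType) (H : hopf_star_alg R) (B A : h_star_alg H).
Variable E : h_bimod B A.
Context {sB : is_star_alg B} {sA : is_star_alg A}.
Context {aB : is_star_action B} {aA : is_star_action A}.
Context {hE : is_equivalence_bimodule E} {cE : is_covariant E}.
Implicit Types (g h k : H) (x y z : E) (t u v : tensor E H).
Local Notation S := (@antipode R H).
Local Notation actA := (@hsa_act R H A).
Local Notation actB := (@hsa_act R H B).
Local Notation actE := (@hb_act R H B A E).
Local Notation ripE := (@rip R B A E).
Local Notation ractE := (@ract R B A E).
Local Notation xl := (@lact R (crossed B) (crossed A) (crossed_pre E)).
Local Notation xr := (@ract R (crossed B) (crossed A) (crossed_pre E)).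
Local Notation xrip := (@rip R (crossed B) (crossed A) (crossed_pre E)).
Local Notation xlip := (@lip R (crossed B) (crossed A) (crossed_pre E)).

Let mE : is_h_module actE := hb_module cE.

Lemma xlE : xl = xmap actE (@lact R B A E).
Proof. by []. Qed.

Lemma xrE : xr = xmap actA ractE.
Proof. by []. Qed.

#[export] Instance xl_bislin : bislin false false xl.
Proof. by rewrite xlE; typeclasses eauto. Qed.

#[export] Instance xr_bislin : bislin false false xr.
Proof. by rewrite xrE; typeclasses eauto. Qed.

#[export] Instance xrip_bislin : bislin true false xrip.
Proof. by cbn [rip crossed_pre]; bislin. Qed.

#[export] Instance xlip_bislin : bislin false true xlip.
Proof. by cbn [lip crossed_pre]; bislin. Qed.

Lemma xrip_tensl x g u : xrip (x ⊗ g) u = lam actA (hstar g) (lmap ripE x u).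
Proof.
tensor_ext u => y h.
rewrite lmap_tens lam_tens (tsum_Delta_star (s := false)); last by bislin.
rewrite [LHS](tlift_pure (s := true)); last by bislin.
by apply: (tlift_pure (s := false)); bislin.
Qed.

Lemma xrip_tens x g y h :
  xrip (x ⊗ g) (y ⊗ h) = lam actA (hstar g) (⟨x, y⟩r ⊗ h).
Proof. by rewrite xrip_tensl lmap_tens. Qed.

(* The left inner product of x ⊗ g and y ⊗ h depends on g and h only through
   k = g h^* *)
Definition lipk x y k : tensor B H :=
  \tsum_(k1, k2 <- Delta k) ⟨x, hstar (S k1) ▶ y⟩l ⊗ k2.

Lemma xlip_tens x g y h : xlip (x ⊗ g) (y ⊗ h) = lipk x y (g * hstar h).
Proof.
rewrite [LHS](tlift_pure (s := false)); last by bislin.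
rewrite [LHS](tlift_pure (s := true)); last by bislin.
rewrite /lipk (tsum_DeltaM (s := false)); last by bislin.
apply: eq_tlift => g1 g2; rewrite (tsum_Delta_star (s := false)); last by bislin.
by apply: eq_tlift => h1 h2; rewrite antipode_mul hstarM.
Qed.

Lemma lipk1 x y : lipk x y 1 = ⟨x, y⟩l ⊗ 1.
Proof.
rewrite /lipk (tsum_Delta1 (s := false)); last by bislin.
by rewrite antipode1 hstar1 (hm_one mE).
Qed.

(** Covariance puts [hstar (S g2)] in front of [hstar (S k1) ▶ y], and they fuse to
    [hstar (S (g2 * k1))], the twist that belongs to the coproduct of [g2 * k]. *)
Lemma lam_lipk g x y k :
  lam actB g (lipk x y k) = \tsum_(g1, g2 <- Delta g) lipk (g1 ▶ x) y (g2 * k).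
Proof.
rewrite (slin_tlift (f := lam actB g)).
under eq_tlift => k1 k2.
  rewrite lam_tens; under eq_tlift => d g3.
    rewrite (hb_lip cE).
    rewrite (slin_tlift (f := fun b => b ⊗ (g3 * k2))
      (fL := bislinl (tens_bislin _ _) _)).
    under eq_tlift => g1 g2 do rewrite -(hm_mul mE) -hstarM -antipode_mul.
  over.
  rewrite (tsum_coassoc (s := false) (F := fun g1 g2 g3 =>
    ⟨g1 ▶ x, hstar (S (g2 * k1)) ▶ y⟩l ⊗ (g3 * k2))); last by trislin.
over.
rewrite exchange_tlift; apply: eq_tlift => g1 d.
rewrite exchange_tlift /lipk (tsum_DeltaM (s := false)) //.
by bislin.
Qed.

(** The star moves [hstar (S k1)] to the first argument, where a leg of [hstar k2] from [lam]
    cancels it. *)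
Lemma xstar_lipk x y k :
  @sa_star R (crossed B) (lipk y x k) = lipk x y (hstar k).
Proof.
rewrite (slin_tlift (f := @sa_star R (crossed B))).
under eq_tlift => k1 d.
  rewrite xstar_tens -(lip_sym hE) -lipk1 lam_lipk.
  rewrite (tsum_Delta_star (s := false)); last by (rewrite /lipk; bislin).
  under eq_tlift => k2 k3 do rewrite mulr1 -(hm_mul mE) -hstarM.
over.
rewrite (tsum_Sl (s := true)
  (F := fun u w : H => lipk (hstar u ▶ x) y (hstar w))).
  by rewrite hstar1 (hm_one mE).
by rewrite /lipk; bislin.
Qed.

Lemma lipk_lact b x y k : lipk (b ·l x) y k = lmap (@sa_mul R B) b (lipk x y k).
Proof.
rewrite (slin_tlift (f := lmap _ b)); apply: eq_tlift => k1 k2.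
by rewrite lmap_tens (lip_lact hE).
Qed.

(** This is [lip_rip] with [k] inserted between the two inner products: formally, x k ⟨y, t⟩. *)
Lemma xl_lipk x y k t :
  xl (lipk x y k) t = lmap ractE x (lam actA k (lmap ripE y t)).
Proof.
tensor_ext t => z l.
rewrite lmap_tens lam_tens (slin_tlift (f := lmap ractE x)).
under [RHS]eq_tlift => d k3.
  rewrite lmap_tens (hb_rip cE) (slin_tlift (f := ractE x)).
  rewrite (slin_tlift (f := fun b => b ⊗ (k3 * l))
    (fL := bislinl (tens_bislin _ _) _)).
over.
rewrite (tsum_coassoc (s := false) (F := fun k1 k2 k3 =>
  (x ·r ⟨hstar (S k1) ▶ y, k2 ▶ z⟩r) ⊗ (k3 * l))); last by trislin.
rewrite (slin_tlift (f := fun s => xl s _) (fL := bislinl xl_bislin _)).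
apply: eq_tlift => k1 d; rewrite xlE xmap_tens.
by apply: eq_tlift => k2 k3; rewrite (lip_rip hE).
Qed.

(** Serves fullness of the left inner product. The twist inside [lipk] meets [hstar k1] and cancels
    as [hstar (k1 * S k2)]. *)
Lemma lip_tens_lipk x y k : ⟨x, y⟩l ⊗ k =
  \tsum_(k1, k2 <- Delta k) lipk x (hstar k1 ▶ y) k2.
Proof.
under [RHS]eq_tlift => k1 d.
  rewrite /lipk; under eq_tlift => k2 k3 do rewrite -(hm_mul mE) -hstarM.
over.
rewrite (tsum_Sr (s := false) (F := fun u w : H => ⟨x, hstar u ▶ y⟩l ⊗ w)).
  by rewrite hstar1 (hm_one mE).
by bislin.
Qed.

(** In contrast with the tensor product of bimodules, the compatibility is strict here, before
    degenerate vectors are divided out. *)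
Lemma xl_xlip t u v : xl (xlip t u) v = xr t (xrip u v).
Proof.
tensor_ext t => x g; tensor_ext_as true u => y h.
by rewrite xlip_tens xl_lipk xrip_tensl xrE xmap_tensl lam_mul.
Qed.

Lemma crossed_pre_equivalence : pre_equivalence (crossed_pre E).
Proof.
have pE : pre_covariant E by exact: pre_covariant_of.
have [_ _ lE rE lrE _ _] := eb_bimodule hE.
have mulE (C : h_star_alg H) (aC : is_star_action C) :
    equivariant (@hsa_act R H C) (@hsa_act R H C) (@hsa_act R H C) (@sa_mul R C).
  exact: hsa_mul aC.
split; try by typeclasses eauto.
- move=> b c t; rewrite xlE crossed_mulE.
  by apply: (xmapA (m := @sa_mul R B) (n := @lact R B A E)
    (n' := @lact R B A E) (pc_lact pE)) => ? ? ?; rewrite lE.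
- move=> t a c; rewrite xrE crossed_mulE; apply/esym.
  by apply: (xmapA (m := ractE) (n := ractE) (n' := ractE) (mulE _ aA))
    => ? ? ?; rewrite rE.
- move=> b t a; rewrite xrE xlE.
  by apply: (xmapA (m := @lact R B A E) (n := ractE)
    (n' := @lact R B A E) (pc_ract pE)) => ? ? ?; rewrite lrE.
- elim/tensor_ind => [|t u|z h]; [exact: span0|exact: spanD|].
  apply: (span_map (f := fun z => z ⊗ h) _ _ (lact_full hE z)); first by slin.
  move=> _ [b [x ->]]; apply: span_sub; exists (b ⊗ 1), (x ⊗ h).
  by rewrite xlE xmap_tens1.
- elim/tensor_ind => [|t u|z h]; [exact: span0|exact: spanD|].
  apply: (span_map (f := fun z => z ⊗ h) _ _ (ract_full hE z)); first by slin.
  move=> _ [x [a ->]]; apply: span_sub; exists (x ⊗ 1), (a ⊗ h).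
  by rewrite xrE xmap_tens1.
- move=> t u a; tensor_ext_as true t => x g; tensor_ext u => y h.
  rewrite !xrip_tensl lmap_tens crossed_mulE -(lam_xmap (mulE _ _)).
  rewrite xrE !xmap_tensl; congr (lam _ _ _); move: (lam _ h a) => {}a.
  by tensor_ext a => b k; rewrite !lmap_tens (rip_ract hE).
- move=> t u; tensor_ext_as true t => x g; tensor_ext u => y h.
  by rewrite !xrip_tens xstar_lam -(rip_sym hE) hstarK.
- elim/tensor_ind => [|t u|a h]; [exact: span0|exact: spanD|].
  apply: (span_map (f := fun a => a ⊗ h) _ _ (rip_full hE a)); first by slin.
  move=> _ [x [y ->]]; apply: span_sub; exists (x ⊗ 1), (y ⊗ h).
  by rewrite xrip_tens hstar1 lam1.
- move=> s t u; tensor_ext s => b k; tensor_ext t => x g.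
  tensor_ext_as true u => y h.
  rewrite xlE crossed_mulE xmap_tens xmap_tensl xlip_tens lam_lipk.
  rewrite (slin_tlift (f := fun t => xlip t _) (fL := bislinl xlip_bislin _)).
  rewrite (slin_tlift (f := lmap _ b)); apply: eq_tlift => k1 k2.
  by rewrite xlip_tens lipk_lact mulrA.
- move=> t u; tensor_ext t => x g; tensor_ext_as true u => y h.
  by rewrite !xlip_tens xstar_lipk hstarM hstarK.
- elim/tensor_ind => [|t u|b k]; [exact: span0|exact: spanD|].
  apply: (span_map (f := fun b => b ⊗ k) _ _ (lip_full hE b)); first by slin.
  move=> _ [x [y ->]]; rewrite lip_tens_lipk; apply: span_tlift => k1 k2.
  apply: span_sub; exists (x ⊗ k2), ((hstar k1 ▶ y) ⊗ 1).
  by rewrite xlip_tens hstar1 mulr1.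
- by move=> w x y z; rewrite xl_xlip.
- by move=> x y z w; rewrite xl_xlip.
Qed.

End CrossedBimodule.

(** * Complete positivity *)

Section Positivity.
Variables (R : realDomainType) (H : hopf_star_alg R) (A : h_star_alg H).
Context {sA : is_star_alg A} {aA : is_star_action A}.
Implicit Types (g h k : H) (a b : A).
Local Notation lamA := (lam (@hsa_act R H A)).

Lemma nneg_sum (I : Type) (r : seq I) (P : pred I) (F : I -> Cx R) :
  (forall i, P i -> nneg (F i)) -> nneg (\sum_(i <- r | P i) F i).
Proof.
move=> F0; elim/big_ind: _ => // -[a b] [c d] [/= -> a0] [/= -> c0].
by split; rewrite /= ?addr0 ?addr_ge0.
Qed.

Lemma xstar_mul a g (t : tensor A H) :
  (a ⊗ g : crossed A)^★ ·m t = lamA (hstar g) (lmap (@sa_mul R A) a^★ t).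
Proof.
have mE : equivariant (@hsa_act R H A) (@hsa_act R H A) (@hsa_act R H A)
  (@sa_mul R A) by exact: hsa_mul aA.
by rewrite xstar_tens crossed_mulE -(lam_xmap mE) xmap_tensl lam1.
Qed.

Lemma mat_mulE n (B : star_alg R) (a b : mat_alg n B) i j :
  (a ·m b) (i, j) = \sum_k a (i, k) ·m b (k, j).
Proof. by rewrite ffunE. Qed.

Lemma mat_starE n (B : star_alg R) (a : mat_alg n B) i j :
  a^★ (i, j) = (a (j, i))^★.
Proof. by rewrite ffunE. Qed.

Section Pullback.
Variables (n N : nat) (c : 'I_N -> 'I_n) (d : 'I_N -> H).

(** An index below [N] stands for one elementary tensor occurring in a family of [n] vectors: [c]
    tells in which vector it occurs, and [d] is its factor in [H]. *)
Definition spread (a : mat_alg N A) : mat_alg n (crossed A) :=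
  [ffun p => \sum_(k | c k == p.1) \sum_(l | c l == p.2)
     lamA (hstar (d k)) (a (k, l) ⊗ d l)].

Lemma spread_slin : slin false spread.
Proof.
move=> z a b; apply/ffunP => p; rewrite !ffunE /= scaler_sumr -big_split /=.
apply: eq_bigr => k _; rewrite scaler_sumr -big_split /=.
apply: eq_bigr => l _; rewrite !ffunE.
by rewrite tensDl tensZl (slinP (f := lamA _)).
Qed.

(* Row r of [a] becomes the element σ_r of the crossed product with entries
   σ_r(j) = \sum_(c l == j) a(r, l) ⊗ d_l, and [spread (a^* a)] is the sum over
   r of the matrices (σ_r(i)^* σ_r(j)), each of which is a hermitian square *)
Lemma spread_positive (omega : mat_alg n (crossed A) -> Cx R) :
  positive_functional omega -> positive_functional (omega \o spread).
Proof.
move=> [omegaL omega0]; split=> [z a b|a] /=.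
  by rewrite spread_slin omegaL.
have omegaD : {morph omega : u v / u + v}.
  by move=> u v; have := omegaL 1 u v; rewrite scale1r mul1r.
have omega00 : omega 0 = 0.
  by apply: (@addrI _ (omega 0)); rewrite -omegaD !addr0.
pose sig (r : 'I_N) (j : 'I_n) : crossed A := \sum_(l | c l == j) a (r, l) ⊗ d l.
(* A matrix with the single nonzero row σ_r has the hermitian square with entries σ_r(i)^★ σ_r(j),
   wherever that row sits; [c r] is an index at hand. *)
pose C (r : 'I_N) : mat_alg n (crossed A) :=
  [ffun p => if p.1 == c r then sig r p.2 else 0].
suff -> : spread (a^★ ·m a) = \sum_r (C r)^★ ·m C r.
  rewrite (big_morph omega omegaD omega00).
  by apply: nneg_sum => r _; apply: omega0.
have sC : is_star_alg (crossed A) by exact: crossed_star_alg.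
have CE r (k j : 'I_n) : C r (k, j) = if k == c r then sig r j else 0.
  by rewrite ffunE.
apply/ffunP => -[i j]; rewrite sum_ffunE ffunE.
transitivity (\sum_r (sig r i)^★ ·m sig r j); last first.
  apply: eq_bigr => r _; rewrite mat_mulE (bigD1 (c r)) // big1 => [|k /negbTE kr].
    by rewrite [RHS]addr0 mat_starE !CE eqxx.
  by rewrite CE kr sa_mul0.
transitivity (\sum_r \sum_(k | c k == i) \sum_(l | c l == j)
    lamA (hstar (d k)) (((a (r, k))^★ ·m a (r, l)) ⊗ d l)).
  rewrite [RHS]exchange_big; apply: eq_bigr => k _ /=.
  rewrite [RHS]exchange_big; apply: eq_bigr => l _ /=.
  rewrite mat_mulE -(slin_sum (f := lamA _)); congr (lam _ _ _).
  rewrite -(slin_sum (f := fun a => a ⊗ d l)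
    (fL := bislinl (tens_bislin _ _) _)).
  by congr (_ ⊗ _); apply: eq_bigr => r _; rewrite mat_starE.
apply: eq_bigr => r _.
rewrite /sig (slin_sum (f := @sa_star R (crossed A))).
rewrite (slin_sum (f := fun u => u ·m _)
  (fL := bislinl (op := @sa_mul R (crossed A)) _ _)).
apply: eq_bigr => k _; rewrite (slin_sum (f := sa_mul _)).
by apply: eq_bigr => l _; rewrite xstar_mul lmap_tens.
Qed.

End Pullback.

(** Common criterion for both inner products: a matrix of this shape is [spread] of a Gram matrix of
    [ip], and positive functionals pull back along [spread]. *)
Lemma crossed_completely_positive (V : Type) (ip : V -> V -> A) :
  completely_positive ip ->
  forall n (M : mat_alg n (crossed A)) (s : 'I_n -> seq (V * H)),
  (forall i j, M (i, j) = \sum_(p <- s i) \sum_(q <- s j)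
     lamA (hstar p.2) (ip p.1 q.1 ⊗ q.2)) -> positive_elt M.
Proof.
move=> ipP n M s ME omega omegaP.
(* The sums [s i] may differ in length; they are flattened into one list, whose positions index the
   larger matrix. *)
pose L := [seq (i, p) | i <- enum 'I_n, p <- s i].
pose q := tnth (in_tuple L).
have := ipP _ (fun i => (q i).2.1) _
  (@spread_positive n (size L) (fun i => (q i).1) (fun i => (q i).2.2)
    omega omegaP).
rewrite /=; congr (nneg (omega _)); apply/ffunP => -[i j].
rewrite ME ffunE /=.
have LE (F : 'I_n * (V * H) -> tensor A H) (i' : 'I_n) :
    \sum_(k | (q k).1 == i') F (q k) = \sum_(p <- s i') F (i', p).
  rewrite /q -(big_tnth _ _ L (fun p => p.1 == i') F) big_mkcond /L.
  rewrite big_allpairs_dep big_enum /= (bigD1 i') //= eqxx.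
  rewrite [X in _ + X]big1 ?addr0 // => k /negbTE ->.
  exact: big1.
rewrite -(LE (fun p => \sum_(r <- s j)
  lamA (hstar p.2.2) (ip p.2.1 r.1 ⊗ r.2))).
apply: eq_bigr => k _.
rewrite -(LE (fun r => lamA (hstar (q k).2.2) (ip (q k).2.1 r.2.1 ⊗ r.2.2))).
by apply: eq_bigr => l _; rewrite ffunE.
Qed.

End Positivity.

Section CrossedPositivity.
Variables (R : realDomainType) (H : hopf_star_alg R) (B A : h_star_alg H).
Variable E : h_bimod B A.
Context {sB : is_star_alg B} {sA : is_star_alg A}.
Context {aB : is_star_action B} {aA : is_star_action A}.
Context {hE : is_equivalence_bimodule E} {cE : is_covariant E}.
Implicit Types (g h k : H) (x y z : E) (t u v : tensor E H).
Local Notation lamB := (lam (@hsa_act R H B)).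
Local Notation lamE := (lam (@hb_act R H B A E)).
Local Notation xrip := (@rip R (crossed B) (crossed A) (crossed_pre E)).
Local Notation xlip := (@lip R (crossed B) (crossed A) (crossed_pre E)).

Lemma crossed_rip_positive : completely_positive (@rip R B A E) ->
  completely_positive (@rip R _ _ (crossed_bimod E)).
Proof.
move=> cp n u.
apply: (crossed_completely_positive cp (s := fun i => trepr (qrepr (u i)))).
move=> i j; rewrite ffunE.
change (xrip (qrepr (u i)) (qrepr (u j)) = \sum_(p <- trepr (qrepr (u i)))
  \sum_(q <- trepr (qrepr (u j)))
    lam (@hsa_act R H A) (hstar p.2) (⟨p.1, q.1⟩r ⊗ q.2)).
move: (qrepr (u i)) (qrepr (u j)) => t t'.
rewrite {1}[t]tensor_sum.
rewrite (slin_sum (f := fun t => xrip t t') (fL := bislinl (op := xrip) _ _)).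
apply: eq_bigr => p _; rewrite {1}[t']tensor_sum (slin_sum (f := xrip _)).
by apply: eq_bigr => q _; rewrite xrip_tens.
Qed.

Lemma xlip_lam g t u : xlip (lamE g t) u = lamB g (xlip t u).
Proof.
tensor_ext t => x k; tensor_ext_as true u => y h.
rewrite lam_tens xlip_tens lam_lipk.
rewrite (slin_tlift (f := fun t => xlip t _) (fL := bislinl (op := xlip) _ _)).
by apply: eq_tlift => g1 g2; rewrite xlip_tens mulrA.
Qed.

Lemma xlip_lam_lam g h x y :
  xlip (lamE g (x ⊗ 1)) (lamE h (y ⊗ 1)) = lamB g (⟨x, y⟩l ⊗ hstar h).
Proof.
have pE : pre_equivalence (crossed_pre E) by exact: crossed_pre_equivalence.
rewrite xlip_lam; congr (lam _ _ _); rewrite (pe_lip_sym pE) xlip_lam xlip_tens.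
by rewrite hstar1 mulr1 lipk1 xstar_lam hstar1 lam1 -(lip_sym hE).
Qed.

(** By [xlip_lam_lam], vectors of this form have left inner products of the shape that
    [crossed_completely_positive] asks for. *)
Lemma lam_generates t :
  exists s : seq (E * H), t = \sum_(p <- s) lamE (hstar p.2) (p.1 ⊗ 1).
Proof.
elim/tensor_ind: t => [|t u [s ->] [r ->]|x g].
- by exists [::]; rewrite big_nil.
- by exists (s ++ r); rewrite big_cat.
(* Applying [lam g2] creates a leg in front of [antipode_inv g1 ▶ x] that cancels it, leaving x ⊗ g.
   The star on [p.2] offsets the one in the statement. *)
exists [seq (antipode_inv p.1 ▶ x, hstar p.2) | p <- trepr (Delta g)].
rewrite big_map.
transitivity (\tsum_(g1, g2 <- Delta g) lamE g2 ((antipode_inv g1 ▶ x) ⊗ 1)).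
  under eq_tlift => g1 d.
    rewrite lam_tens.
    under eq_tlift => g2 g3 do rewrite mulr1 -(hm_mul (hb_module cE)).
  over.
  rewrite (tsum_Sinvr (s := false) (F := fun u w : H => (u ▶ x) ⊗ w)).
    by rewrite (hm_one (hb_module cE)).
  by bislin.
by apply: eq_bigr => p _; rewrite hstarK.
Qed.

Lemma crossed_lip_positive : completely_positive (@lip R B A E) ->
  completely_positive (@lip R _ _ (crossed_bimod E)).
Proof.
move=> cp n u.
pose s i := sval (cid (lam_generates (qrepr (u i)))).
have sE i : qrepr (u i) = \sum_(p <- s i) lamE (hstar p.2) (p.1 ⊗ 1).
  by rewrite /s; case: cid.
apply: (crossed_completely_positive cp (s := s)) => i j; rewrite ffunE.
change (xlip (qrepr (u i)) (qrepr (u j)) = \sum_(p <- s i) \sum_(q <- s j)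
    lamB (hstar p.2) (⟨p.1, q.1⟩l ⊗ q.2)).
rewrite !sE.
rewrite (slin_sum (f := fun t => xlip t _) (fL := bislinl (op := xlip) _ _)).
apply: eq_bigr => p _; rewrite (slin_sum (f := xlip _)).
by apply: eq_bigr => q _; rewrite xlip_lam_lam hstarK.
Qed.

End CrossedPositivity.

(** * Unit bimodules *)

Section Unit.
Variable R : realDomainType.

Lemma unit_equivalence (A : star_alg R) :
  pic_obj A -> is_equivalence_bimodule (bimod_unit A).
Proof.
case=> sA iA nA.
have pA : pre_equivalence (bimod_unit A).
  split=> //=.
  - exact: sa_mul_bislin.
  - exact: sa_mul_bislin.
  - by split=> ?; slin.
  - by split=> ?; slin.
  - by move=> b c x; rewrite (sa_assoc sA).
  - by move=> x a c; rewrite (sa_assoc sA).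
  - by move=> b x a; rewrite (sa_assoc sA).
  - by move=> x y a; rewrite (sa_assoc sA).
  - by move=> x y; rewrite (sa_starM sA) (sa_starK sA).
  - move=> a; apply: sub_span (iA a) => _ [b [c ->]]; apply: span_sub.
    by exists b^★, c; rewrite (sa_starK sA).
  - by move=> b x y; rewrite (sa_assoc sA).
  - by move=> x y; rewrite (sa_starM sA) (sa_starK sA).
  - move=> a; apply: sub_span (iA a) => _ [b [c ->]]; apply: span_sub.
    by exists b, c^★; rewrite (sa_starK sA).
  - by move=> w x y z; rewrite !(sa_assoc sA).
  - by move=> x y z w; rewrite !(sa_assoc sA).
apply: is_equivalence_of_nondegenerate => // a Da.
rewrite -[a](sa_starK sA) (nA a^★) ?(slin0 (f := @sa_star R A)) //.
by left=> b; apply: Da.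
Qed.

Variable H : hopf_star_alg R.

Lemma unit_covariant (A : h_star_alg H) :
  is_star_action A -> is_covariant (h_bimod_unit A).
Proof.
move=> aA; split=> [|g x y|g x y] /=; first exact: hsa_module.
  rewrite (hsa_mul aA); apply: eq_tlift => g1 g2.
  by rewrite (hsa_star aA) antipode_star.
rewrite (hsa_mul aA); apply: eq_tlift => g1 g2.
by rewrite (hsa_star aA) antipode_star.
Qed.

End Unit.

(** * Functoriality *)

#[global] Existing Instance crossed_star_alg.
#[global] Existing Instance crossed_pre_equivalence.

Section CrossedArrow.
Variables (R : realDomainType) (H : hopf_star_alg R) (B A : h_star_alg H).
Context {sB : is_star_alg B} {sA : is_star_alg A}.
Context {aB : is_star_action B} {aA : is_star_action A}.
Hypotheses (nB : nondegenerate_alg (crossed B))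
  (nA : nondegenerate_alg (crossed A)).
Section Generators.
Variable E : h_bimod B A.
Context {hE : is_equivalence_bimodule E} {cE : is_covariant E}.

Lemma crossed_equivalence : is_equivalence_bimodule (crossed_bimod E).
Proof. exact: dquot_equivalence. Qed.

Definition cgen (t : tensor E H) : crossed_bimod E :=
  qproj (degeneracy (crossed_pre E)) t.

#[export] Instance cgen_slin : slin false cgen.
Proof. exact: qproj_slin. Qed.

Lemma cgen_rip t u : ⟨cgen t, cgen u⟩r = @rip R _ _ (crossed_pre E) t u.
Proof. exact: dquot_rip. Qed.

Lemma cgen_lact b t : b ·l cgen t = cgen (@lact R _ _ (crossed_pre E) b t).
Proof. exact: dquot_lact. Qed.

Lemma cgen_ract t a : cgen t ·r a = cgen (@ract R _ _ (crossed_pre E) t a).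
Proof. exact: dquot_ract. Qed.

Lemma cgen_span (S : set E) u : (forall x, span S x) ->
  span [set v | exists x g, S x /\ v = cgen (x ⊗ g)] u.
Proof.
move=> ES; elim/qprojP: u => t; rewrite -[qproj _ t]/(cgen t).
elim/tensor_ind: t => [|t u St Su|x g].
- by rewrite (slin0 (f := cgen)); apply: span0.
- by rewrite (slinD (f := cgen)); apply: spanD.
apply: (span_map (f := fun x => cgen (x ⊗ g)) _ _ (ES x)); first by slin.
by move=> y Sy; apply: span_sub; exists y, g.
Qed.

End Generators.

Lemma crossed_iso (E E' : h_bimod B A) :
  is_equivalence_bimodule E -> is_covariant E ->
  is_equivalence_bimodule E' -> is_covariant E' ->
  h_bimod_iso E E' -> bimod_iso (crossed_bimod E) (crossed_bimod E').
Proof.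
move=> hE cE hE' cE' [f [[f' fK f'K] [fL fl fr flip frip] fact]].
apply: (gram_iso nB (I := E * H) (p := fun i => cgen (i.1 ⊗ i.2))
  (q := fun i => cgen (f i.1 ⊗ i.2))).
- exact: crossed_equivalence.
- exact: crossed_equivalence.
- move=> u; apply: sub_span (cgen_span (S := setT) u _) => [_ [x [g [_ ->]]]|x].
    by apply: span_sub; exists (x, g).
  exact: span_sub.
- move=> u; apply: sub_span (cgen_span (S := setT) u _) => [_ [x [g [_ ->]]]|x].
    by apply: span_sub; exists (f' x, g); rewrite /= f'K.
  exact: span_sub.
- by move=> [x g] [y h]; cbn [fst snd]; rewrite !cgen_rip !xrip_tens frip.
move=> b [x g] [y h]; cbn [fst snd]; rewrite !cgen_lact !cgen_rip.
tensor_ext b => b k.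
rewrite !xlE !xmap_tens !(slin_tlift (f := @rip R _ _ (crossed_pre _) _)).
by apply: eq_tlift => k1 k2; rewrite !xrip_tens -fact -fl frip.
Qed.

End CrossedArrow.

Section CrossedUnit.
Variables (R : realDomainType) (H : hopf_star_alg R) (A : h_star_alg H).
Hypothesis pA : picH_obj A.

Lemma crossed_obj : pic_obj (crossed A).
Proof.
case: pA => -[sA iA nA] aA xA.
by split=> //; [exact: crossed_star_alg|exact: crossed_idempotent].
Qed.

(** On A ⊗ H both right inner products are t^★ u and both left actions are the product. The left
    inner products, given by different formulas, agree because [gram_iso] forces them to. *)
Lemma crossed_unit_iso :
  bimod_iso (crossed_bimod (h_bimod_unit A)) (bimod_unit (crossed A)).
Proof.
have [[sA iA nA] aA xA] := pA.
have hU : is_equivalence_bimodule (h_bimod_unit A) by exact: unit_equivalence.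
have cU : is_covariant (h_bimod_unit A) by exact: unit_covariant.
have hxU : is_equivalence_bimodule (bimod_unit (crossed A)).
  exact: unit_equivalence crossed_obj.
have ripU (t u : tensor A H) :
    @rip R _ _ (crossed_pre (h_bimod_unit A)) t u = (t : crossed A)^★ ·m u.
  tensor_ext_as true t => a g; tensor_ext u => b h.
  by rewrite xrip_tens xstar_mul lmap_tens.
apply: (gram_iso xA (I := tensor A H)
  (p := fun t => cgen (t : tensor (h_bimod_unit A) H))
  (q := fun t => t : bimod_unit (crossed A))).
- exact: crossed_equivalence.
- by elim/qprojP=> t; apply: span_sub; exists t.
- by move=> t; apply: span_sub; exists t.
- by move=> t u; rewrite cgen_rip ripU.
- by move=> b t u; rewrite cgen_lact // cgen_rip ripU.
Qed.

End CrossedUnit.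

Section CrossedComposition.
Variables (R : realDomainType) (H : hopf_star_alg R) (C B A : h_star_alg H).
Variables (F : h_bimod C B) (E : h_bimod B A).
Hypotheses (pC : picH_obj C) (pB : picH_obj B) (pA : picH_obj A).
Context {hF : is_equivalence_bimodule F} {cF : is_covariant F}.
Context {hE : is_equivalence_bimodule E} {cE : is_covariant E}.
Local Notation P := (crossed_bimod (h_bimod_comp F E)).
Local Notation Q := (bimod_comp (crossed_bimod F) (crossed_bimod E)).

Let sC : is_star_alg C. Proof. by case: pC => -[]. Qed.
Let sB : is_star_alg B. Proof. by case: pB => -[]. Qed.
Let sA : is_star_alg A. Proof. by case: pA => -[]. Qed.
Let nC : nondegenerate_alg C. Proof. by case: pC => -[]. Qed.
Let nA : nondegenerate_alg A. Proof. by case: pA => -[]. Qed.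
Let aC : is_star_action C. Proof. by case: pC. Qed.
Let aB : is_star_action B. Proof. by case: pB. Qed.
Let aA : is_star_action A. Proof. by case: pA. Qed.
Let xC : nondegenerate_alg (crossed C). Proof. by case: pC. Qed.
Let xB : nondegenerate_alg (crossed B). Proof. by case: pB. Qed.
Let xA : nondegenerate_alg (crossed A). Proof. by case: pA. Qed.

(* The isomorphism sends (y ⊗ x) ⊗ g to (y ⊗ 1) ⊗ (x ⊗ g) *)
Lemma crossed_comp_iso : bimod_iso P Q.
Proof.
move: sC sB sA aC aB aA => sC' sB' sA' aC' aB' aA'.
have pF : pre_covariant F by exact: pre_covariant_of.
have pE : pre_covariant E by exact: pre_covariant_of.
have [hFE cFE] := h_comp_arr (F := F) (E := E) nC nA.
have hP : is_equivalence_bimodule P by exact: crossed_equivalence.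
have hxF : is_equivalence_bimodule (crossed_bimod F).
  exact: crossed_equivalence.
have hxE : is_equivalence_bimodule (crossed_bimod E).
  exact: crossed_equivalence.
have hQ : is_equivalence_bimodule Q by exact: comp_equivalence.
pose p (y : F) (x : E) (g : H) : P :=
  cgen ((comp_tens y x : h_bimod_comp F E) ⊗ g).
pose q (y : F) (x : E) (g : H) : Q := comp_tens (cgen (y ⊗ 1)) (cgen (x ⊗ g)).
pose ct := @comp_tens R _ _ _ (crossed_bimod F) (crossed_bimod E).
have ctB : bislin false false ct by exact: comp_tens_bislin.
have move_b (y : F) b k t : comp_tens (cgen ((y ·r b) ⊗ k)) (cgen t) =
    comp_tens (cgen (y ⊗ 1)) (cgen (@lact R _ _ (crossed_pre E) (b ⊗ k) t)).
  rewrite -(cgen_lact xA) -comp_balanced cgen_ract //.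
  by rewrite xrE xmap_tens1.
(* The factor [k] can cross the tensor sign only together with some [b] split off from [y];
   afterwards [b] returns to the left by [move_b] read backwards at k = 1. *)
have move_k (y : F) k x g : comp_tens (cgen (y ⊗ k)) (cgen (x ⊗ g)) =
    \tsum_(k1, k2 <- Delta k) q y (k1 ▶ x) (k2 * g).
  apply/eqP; rewrite -subr_eq0; apply/eqP; rewrite /q.
  apply: (span_map0 (s := false) (f := fun y =>
    comp_tens (cgen (y ⊗ k)) (cgen (x ⊗ g)) - \tsum_(k1, k2 <- Delta k)
    comp_tens (cgen (y ⊗ 1)) (cgen ((k1 ▶ x) ⊗ (k2 * g)))) _ _ (ract_full hF y)).
    by apply: slin_sub; slin.
  move=> _ [y' [b ->]]; apply/eqP; rewrite subr_eq0; apply/eqP.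
  rewrite move_b xlE xmap_tens (slin_tlift (f := @cgen R H B A E)).
  rewrite (slin_tlift (f := comp_tens _)); apply: eq_tlift => k1 k2.
  by rewrite move_b xlE xmap_tens1.
have p_rip y x g y' x' g' : ⟨p y x g, p y' x' g'⟩r = ⟨q y x g, q y' x' g'⟩r.
  rewrite cgen_rip xrip_tens /q !comp_ripE // cgen_rip xrip_tens hstar1 lam1.
  by rewrite cgen_lact // cgen_rip xlE xmap_tens1 xrip_tens.
have p_lact c k y x g : (c ⊗ k : crossed C) ·l p y x g =
    \tsum_(k1, d <- Delta k) \tsum_(k2, k3 <- Delta d)
      p (c ·l (k1 ▶ y)) (k2 ▶ x) (k3 * g).
  rewrite /p cgen_lact // xlE xmap_tens (slin_tlift (f := @cgen R H C A _)).
  rewrite -(tsum_coassoc (s := false) (F := fun k1 k2 k3 =>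
    p (c ·l (k1 ▶ y)) (k2 ▶ x) (k3 * g))); last by (rewrite /p; trislin).
  apply: eq_tlift => d k3; rewrite comp_actE //.
  have fL : slin false (fun v : h_bimod_comp F E => cgen ((c ·l v) ⊗ (k3 * g))).
    by slin.
  rewrite (slin_tlift (fL := fL)); apply: eq_tlift => k1 k2.
  by rewrite /p comp_lactE.
(* In [P] the second leg reaches [x] through the diagonal action on the composite; here the second
   and third legs first land on y ⊗ 1, and [move_k] carries them over to x ⊗ g. *)
have q_lact c k y x g : (c ⊗ k : crossed C) ·l q y x g =
    \tsum_(k1, d <- Delta k) \tsum_(k2, k3 <- Delta d)
      q (c ·l (k1 ▶ y)) (k2 ▶ x) (k3 * g).
  rewrite /q comp_lactE // cgen_lact // xlE xmap_tens.
  rewrite (slin_tlift (f := @cgen R H C B _)).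
  have fL : slin false (fun u : crossed_bimod F => comp_tens u (cgen (x ⊗ g))).
    by slin.
  rewrite (slin_tlift (fL := fL)); apply: eq_tlift => k1 d.
  by rewrite mulr1 move_k.
apply: (gram_iso xC (I := F * E * H) (p := fun i => p i.1.1 i.1.2 i.2)
  (q := fun i => q i.1.1 i.1.2 i.2)).
- move=> u; apply: sub_span (cgen_span u (comp_span (F := F) (E := E))).
  move=> _ [v [g [[y [x vE]] ->]]]; apply: span_sub.
  by exists (y, x, g); rewrite vE.
- move=> u; apply: sub_span (comp_span u) => _ [s [t ->]].
  elim/qprojP: s => s; elim/qprojP: t => t.
  rewrite -[qproj _ s]/(cgen s) -[qproj _ t]/(cgen t).
  elim/tensor_ind: s => [|s s' Ss Ss'|y k].
  + rewrite (slin0 (f := @cgen R H C B F)) (slin0 (f := fun s => comp_tens s _)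
      (fL := bislinl (op := ct) _ _)).
    exact: span0.
  + rewrite (slinD (f := @cgen R H C B F)) (slinD (f := fun s => comp_tens s _)
      (fL := bislinl (op := ct) _ _)).
    exact: spanD.
  elim/tensor_ind: t => [|t t' St St'|x g].
  + rewrite (slin0 (f := @cgen R H B A E)) (slin0 (f := comp_tens _)).
    exact: span0.
  + rewrite (slinD (f := @cgen R H B A E)) (slinD (f := comp_tens _)).
    exact: spanD.
  rewrite move_k; apply: span_tlift => k1 k2.
  by apply: span_sub; exists (y, k1 ▶ x, k2 * g).
- by move=> [[y x] g] [[y' x'] g']; cbn [fst snd].
move=> c [[y x] g] [[y' x'] g']; cbn [fst snd]; tensor_ext c => c k.
rewrite p_lact q_lact !(slin_tlift (f := rip _)); apply: eq_tlift => k1 d.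
by rewrite !(slin_tlift (f := rip _)); apply: eq_tlift => k2 k3.
Qed.

End CrossedComposition.

Theorem theorem6p17 (R : realDomainType) (H : hopf_star_alg R) :
  @groupoid_morphism (PicH_star H) (Pic_star R)
    (@crossed R H) (@crossed_bimod R H) /\
  @groupoid_morphism (PicH_str H) (Pic_str R)
    (@crossed R H) (@crossed_bimod R H).
Proof.
have crossed_arr (B A : h_star_alg H) (E : h_bimod B A) :
    picH_obj B -> picH_obj A -> is_equivalence_bimodule E -> is_covariant E ->
    is_equivalence_bimodule (crossed_bimod E).
  by move=> [[sB _ _] aB nB] [[sA _ _] aA nA] hE cE; apply: crossed_equivalence.
have crossed_eq (B A : h_star_alg H) (E E' : h_bimod B A) :
    picH_obj B -> picH_obj A ->
    is_equivalence_bimodule E -> is_covariant E ->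
    is_equivalence_bimodule E' -> is_covariant E' ->
    h_bimod_iso E E' -> bimod_iso (crossed_bimod E) (crossed_bimod E').
  move=> [[sB _ _] aB nB] [[sA _ _] aA nA] hE cE hE' cE'.
  exact: crossed_iso.
split; split=> /=.
- exact: crossed_obj.
- by move=> B A E pB pA [hE cE]; apply: crossed_arr.
- by move=> B A E E' pB pA [hE cE] [hE' cE']; apply: crossed_eq.
- by move=> C B A F E pC pB pA [hF cF] [hE cE]; apply: crossed_comp_iso.
- exact: crossed_unit_iso.
- exact: crossed_obj.
(* The two Picard groupoids share composition, units and equality of arrows, so this is the only
   clause with complete positivity in its conclusion. *)
- move=> B A E pB pA [[hE lE rE] cE]; split; first exact: crossed_arr.
  + have [[sB _ _] aB _] := pB; have [[sA _ _] aA _] := pA.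
    exact: crossed_lip_positive.
  + have [[sB _ _] aB _] := pB; have [[sA _ _] aA _] := pA.
    exact: crossed_rip_positive.
- move=> B A E E' pB pA [[hE _ _] cE] [[hE' _ _] cE'].
  exact: crossed_eq.
- by move=> C B A F E pC pB pA [[hF _ _] cF] [[hE _ _] cE]; apply: crossed_comp_iso.
- exact: crossed_unit_iso.
Qed.
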